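(* Let $k\ge 1$ and consider the discrete scheme (S) described in the context. The scheme (S) is gradient-robust. That is, whenever $\boldsymbol g=\boldsymbol 0$ and $\boldsymbol f=\nabla q$ is an admissible gradient force, the scheme (S) admits a hydrostatic solution: there exists $\varrho_h\in Q_h$ such that $\left((\boldsymbol u_h,\widehat{\boldsymbol u}_h),\varrho_h\right)=\left((\boldsymbol 0,\boldsymbol 0),\varrho_h\right)$ solves (S).
   Context: Let $\Omega\subset\mathbb R^d$, $d\in\{2,3\}$, be a bounded Lipschitz domain with a regular quasi-uniform triangulation $\mathcal T$ into simplices $T$. Let $\mathcal F$ be the set of faces and $h$ the maximal cell diameter. Each face $F$ carries a unit normal $\boldsymbol n_F$ of fixed orientation, and $\boldsymbol n$ is the outward unit normal on $\partial T$. $(\cdot,\cdot)_\omega$ is the $L^2(\omega)$ inner product, $(\cdot,\cdot)=(\cdot,\cdot)_\Omega$. The tangential part is $\boldsymbol v_t:=\boldsymbol v-(\boldsymbol v\cdot\boldsymbol n)\boldsymbol n$. Data: $\nu>0$, $c_M>0$, $M>0$, $\boldsymbol g\in \boldsymbol L^\infty(\Omega)$, $\boldsymbol f\in\boldsymbol L^2(\Omega)$, equation of state $p(\varrho)=c_M\varrho$. Spaces: $\boldsymbol V_h:=\{\boldsymbol v_h\in H_0(\mathrm{div},\Omega): \boldsymbol v_h|_T\in [P_k(T)]^d\ \forall T\in\mathcal T\}$ (vanishing normal trace on $\partial\Omega$); $\widehat{\boldsymbol V}_h:=\{\widehat{\boldsymbol v}_h\in \boldsymbol L^2(\mathcal F):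 \widehat{\boldsymbol v}_h|_F\in[P_k(F)]^d,\ \widehat{\boldsymbol v}_h\cdot\boldsymbol n_F=0\ \forall F\in\mathcal F,\ \widehat{\boldsymbol v}_h=0\text{ on }\partial\Omega\}$; $Q_h:=\{\lambda_h\in L^2(\Omega):\lambda_h|_T\in P_{k-1}(T)\ \forall T\in\mathcal T\}$. Scheme (S): find $((\boldsymbol u_h,\widehat{\boldsymbol u}_h),\varrho_h)\in(\boldsymbol V_h\times\widehat{\boldsymbol V}_h)\times Q_h$ such that for all $(\boldsymbol v_h,\widehat{\boldsymbol v}_h)\in\boldsymbol V_h\times\widehat{\boldsymbol V}_h$ and $\lambda_h\in Q_h$ $$a_h((\boldsymbol u_h,\widehat{\boldsymbol u}_h),(\boldsymbol v_h,\widehat{\boldsymbol v}_h))-(p(\varrho_h),\mathrm{div}\,\boldsymbol v_h)=(\boldsymbol f,\boldsymbol v_h)+(\boldsymbol g,\varrho_h\boldsymbol v_h),\qquad c_h(\varrho_h,\boldsymbol u_h,\lambda_h)=0,\qquad (\varrho_h,1)=M,$$ where $$a_h((\boldsymbol u_h,\widehat{\boldsymbol u}_h),(\boldsymbol v_h,\widehat{\boldsymbol v}_h)):=\nu\sum_{T\in\mathcal T}\Big[(\nabla\boldsymbol u_h,\nabla\boldsymbol v_h)_T+(\nabla\boldsymbol u_h\boldsymbol n,(\widehat{\boldsymbol v}_h-\boldsymbol v_h)_t)_{\partial T}+(\nabla\boldsymbol v_h\boldsymbol n,(\widehat{\boldsymbol u}_h-\boldsymbol u_h)_t)_{\partial T}+\tfrac{\alpha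 k^2}{h}((\widehat{\boldsymbol u}_h-\boldsymbol u_h)_t,(\widehat{\boldsymbol v}_h-\boldsymbol v_h)_t)_{\partial T}\Big],$$ $$c_h(\varrho_h,\boldsymbol u_h,\lambda_h):=\sum_{T\in\mathcal T}\Big[-(\varrho_h\boldsymbol u_h,\nabla\lambda_h)_T+(\boldsymbol u_h\cdot\boldsymbol n\,\varrho_h^{up},\lambda_h)_{\partial T}\Big],$$ $\varrho_h^{up}$ is the standard upwind value of $\varrho_h$ with respect to $\boldsymbol u_h$, and $\alpha>0$ is a fixed parameter chosen sufficiently large (for coercivity of $a_h$). A gradient force $\boldsymbol f=\nabla q$ with $q\in H^1(\Omega)$ is called admissible if there is a constant $C\in\mathbb R$ such that $\varrho:=(q-C)/c_M$ is non-negative and satisfies $(\varrho,1)=M$. *)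

(* Defs.v *)
From HB Require Import structures.
From mathcomp Require Import all_boot all_order all_algebra.
From mathcomp Require mpoly.
(* without notations: those of mpoly and of the analysis library clash *)
Import -(notations) mpoly.
From mathcomp Require Import all_classical all_reals all_analysis.

Set Implicit Arguments.
Unset Strict Implicit.
Unset Printing Implicit Defensive.

Import Order.TTheory GRing.Theory Num.Theory.
Import numFieldNormedType.Exports.

Local Open Scope classical_set_scope.
Local Open Scope ring_scope.

(** * Lebesgue measure on row vectors *)

Definition rV_display : measure_display. Proof. exact. Qed.

Section rV_measurable.
Variables (R : realType) (n : nat).

Let coor (i : 'I_n) (v : 'rV[R]_n) : measurableTypeR R := v ord0 i.

Let rV_set0 : g_sigma_preimage coor set0.
Proof. exact: sigma_algebra0. Qed.

Let rV_setC A : g_sigma_preimage coor A -> g_sigma_preimage coor (~` A).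
Proof. exact: sigma_algebraC. Qed.

Let rV_bigcup (F : (set 'rV[R]_n)^nat) :
  (forall i, g_sigma_preimage coor (F i)) ->
  g_sigma_preimage coor (\bigcup_i (F i)).
Proof. exact: sigma_algebra_bigcup. Qed.

(* The sigma-algebra generated by the coordinates, i.e. the Borel sets. *)
HB.instance Definition _ := @isMeasurable.Build rV_display
  'rV[R]_n (g_sigma_preimage coor) rV_set0 rV_setC rV_bigcup.

End rV_measurable.

Lemma measurable_coor (R : realType) n (i : 'I_n) :
  measurable_fun [set: 'rV[R]_n] (fun v => v ord0 i : measurableTypeR R).
Proof.
move=> _ Y mY; rewrite setTI; apply: sub_sigma_algebra => /=.
rewrite -bigcup_seq/=; exists i => /=; first by rewrite mem_index_enum.
by exists Y => //; rewrite setTI.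
Qed.

Lemma measurable_fun_rVP (R : realType) d (T : measurableType d) n
    (f : T -> 'rV[R]_n) :
  (forall i, measurable_fun [set: T] (fun x => f x ord0 i : measurableTypeR R)) ->
  measurable_fun [set: T] f.
Proof.
move=> mf _ A; rewrite setTI.
pose B := [set A : set 'rV[R]_n | measurable (f @^-1` A)].
suff : measurable `<=` B by exact.
apply: smallest_sub.
  split.
  - by rewrite /B/= preimage_set0.
  - by move=> C BC; rewrite /B/= setTD preimage_setC; exact: measurableC.
  - by move=> F BF; rewrite /B/= preimage_bigcup; exact: bigcupT_measurable.
move=> C; rewrite -bigcup_seq => -[i _ [D mD <-]].
rewrite /B/= setTI -[X in measurable X]setTI.
exact: mf.
Qed.

(* [(x, v)] in R x R^n, seen as a point of R^(n+1) *)
Definition rV_cons (R : realType) n (p : measurableTypeR R * 'rV[R]_n) :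
  'rV[R]_n.+1 := row_mx (p.1 : R)%:M p.2.

Lemma rV_cons0 (R : realType) n (p : measurableTypeR R * 'rV[R]_n) :
  rV_cons p ord0 ord0 = p.1.
Proof.
have -> : ord0 = lshift n (ord0 : 'I_1) :> 'I_(1 + n) by exact: val_inj.
by rewrite [LHS]row_mxEl mxE.
Qed.

Lemma rV_consS (R : realType) n (p : measurableTypeR R * 'rV[R]_n) i :
  rV_cons p ord0 (lift ord0 i) = p.2 ord0 i.
Proof.
have -> : lift ord0 i = rshift 1 i :> 'I_(1 + n) by exact: val_inj.
exact: row_mxEr.
Qed.

Lemma measurable_rV_cons (R : realType) n :
  measurable_fun setT (@rV_cons R n).
Proof.
apply: measurable_fun_rVP => i.
have [j ->|->] := unliftP ord0 i.
  rewrite (_ : (fun x => _) = (fun v : 'rV[R]_n => v ord0 j) \o snd).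
    by apply: measurableT_comp; [exact: measurable_coor|exact: measurable_snd].
  by apply/funext => x; rewrite rV_consS.
rewrite (_ : (fun x => _) = fst); first exact: measurable_fst.
by apply/funext => x; rewrite rV_cons0.
Qed.

Section leb_step.
Variables (R : realType) (n : nat).
Variable mu : {sigma_finite_measure set 'rV[R]_n -> \bar R}.

Definition leb_step : set 'rV[R]_n.+1 -> \bar R :=
  pushforward (@lebesgue_measure R \x mu)%E (@rV_cons R n).

Let leb_step0 : leb_step set0 = 0%E.
Proof. by rewrite /leb_step /pushforward preimage_set0 measure0. Qed.

Let leb_step_ge0 A : (0 <= leb_step A)%E.
Proof. by rewrite /leb_step /pushforward measure_ge0. Qed.

Let leb_step_sigma_additive : semi_sigma_additive leb_step.
Proof.
move=> F mF tF mUF; rewrite /leb_step /pushforward preimage_bigcup.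
apply: measure_semi_sigma_additive.
- by move=> k; rewrite -[X in measurable X]setTI; exact: measurable_rV_cons.
- apply/trivIsetP => /= i j _ _ ij; rewrite -preimage_setI.
  by move/trivIsetP : tF => /(_ _ _ _ _ ij) ->//; rewrite preimage_set0.
- rewrite -preimage_bigcup -[X in measurable X]setTI.
  exact: measurable_rV_cons.
Qed.

HB.instance Definition _ := isMeasure.Build _ _ _
  leb_step leb_step0 leb_step_ge0 leb_step_sigma_additive.

Let leb_step_sigma_finite : sigma_finite setT leb_step.
Proof.
have /sigma_finiteP[F [FT Fnd Foo]] :=
  @sigma_finiteT _ _ _ (@lebesgue_measure R).
have /sigma_finiteP[G [GT Gnd Goo]] := @sigma_finiteT _ _ _ mu.
pose H k := [set v : 'rV[R]_n.+1 | F k (v ord0 ord0)] `&`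
  [set v : 'rV[R]_n.+1 | G k (\row_i v ord0 (lift ord0 i))].
have HE k : @rV_cons R n @^-1` (H k) = F k `*` G k.
  apply/seteqP; split => -[x y] /=; rewrite /H/= rV_cons0/=;
    rewrite (_ : \row_i _ = y)//; by apply/rowP => i; rewrite mxE rV_consS.
exists H.
  apply/esym/seteqP; split => // v _.
  have [i _ Fi] : (\bigcup_i F i) (v ord0 ord0) by rewrite -FT.
  have [j _ Gj] : (\bigcup_i G i) (\row_i v ord0 (lift ord0 i)) by rewrite -GT.
  exists (maxn i j) => //; split => /=.
  - by move/subsetPset : (Fnd _ _ (leq_maxl i j)); apply.
  - by move/subsetPset : (Gnd _ _ (leq_maxr i j)); apply.
move=> k; have [mFk Fk] := Foo k; have [mGk Gk] := Goo k; split.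
  apply: measurableI.
  - by rewrite -[X in measurable X]setTI; exact: (measurable_coor ord0).
  - rewrite -[X in measurable X]setTI.
    have mrow : measurable_fun [set: 'rV[R]_n.+1]
        (fun v => \row_(i < n) v ord0 (lift ord0 i)).
      apply: measurable_fun_rVP => i.
      rewrite (_ : (fun x => _) = (fun v : 'rV[R]_n.+1 => v ord0 (lift ord0 i))).
        exact: measurable_coor.
      by apply/funext => v; rewrite mxE.
    exact: mrow.
rewrite /leb_step /pushforward HE product_measure1E//.
by rewrite lte_mul_pinfty// ge0_fin_numE.
Qed.

HB.instance Definition _ := @Measure_isSigmaFinite.Build _ _ _
  leb_step leb_step_sigma_finite.

End leb_step.

(* Product of n copies of the one-dimensional Lebesgue measure *)
Fixpoint leb (R : realType) (n : nat) :
    {sigma_finite_measure set 'rV[R]_n -> \bar R} :=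
  if n is m.+1 then @leb_step R m (leb R m) else dirac (0 : 'rV[R]_0).

(** * Vector calculus on R^d *)

Section calculus.
Variables (R : realType) (d : nat).
Notation E := 'rV[R]_d.
Implicit Types (D : set E) (v : E -> E) (f : E -> R).

Definition dotv (x y : E) : R := \sum_i x ord0 i * y ord0 i.

(* The norm of the library on row vectors is the sup norm. *)
Definition enorm (x : E) : R := Num.sqrt (dotv x x).

Definition diam D : R := sup [set enorm (p.1 - p.2) | p in D `*` D].

(* Radius of the largest Euclidean ball contained in D *)
Definition inradius D : R :=
  sup [set r | exists c : E, forall x, enorm (x - c) <= r -> D x].

Definition component v (i : 'I_d) : E -> R := fun x => v x ord0 i.

Definition partial (i : 'I_d) f : E -> R := fun x => 'D_(delta_mx ord0 i) f x.

Definition grad f : E -> E := fun x => \row_i partial i f x.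

(* Entry (i, j) is the j-th partial derivative of the i-th component. *)
Definition gradv v : E -> 'M[R]_d :=
  fun x => \matrix_(i, j) partial j (component v i) x.

Definition divergence v : E -> R := fun x => \sum_i partial i (component v i) x.

Definition frob (A B : 'M[R]_d) : R := \tr (A *m B^T).

(* (nabla v) n, written as a row vector *)
Definition gradvn v (nu : E) : E -> E := fun x => nu *m (gradv v x)^T.

Definition tang (nu v : E) : E := v - dotv v nu *: nu.

Definition smooth f : Prop :=
  forall (s : seq 'I_d) (x : E), differentiable (foldr partial f s) x.

Definition test_fun D f : Prop :=
  let supp := closure [set x | f x != 0] in
  [/\ smooth f, compact supp & supp `<=` D].

Definition ip D f g : R := \int[leb R d]_(x in D) (f x * g x).

Definition ipv D v w : R := \int[leb R d]_(x in D) dotv (v x) (w x).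

Definition L2 D f : Prop := f \_ D \in Lfun (leb R d) 2%:E.
Definition L2v D v : Prop := forall i, L2 D (component v i).
Definition Linftyv D v : Prop :=
  forall i, component v i \_ D \in Lfun (leb R d) +oo%E.

Definition L2norm D f : \bar R := 'N[leb R d]_2%:E[EFin \o (f \_ D)]%E.

Definition weak_grad D f v : Prop :=
  forall phi, test_fun D phi ->
    forall i, ip D f (partial i phi) = - ip D (component v i) phi.

(* f belongs to H^1(D) and its gradient is v *)
Definition H1_grad D f v : Prop := [/\ L2 D f, L2v D v & weak_grad D f v].

Definition weak_div D v f : Prop :=
  forall phi, test_fun D phi -> ipv D v (grad phi) = - ip D f phi.

(* H_0(div, D) is the closure of the smooth vector fields with compact support
   in D for the norm of H(div, D). On a bounded Lipschitz domain it is the set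
   of the elements of H(div, D) with vanishing normal trace. *)
Definition H0div D v : Prop :=
  L2v D v /\
  exists w : E -> R, [/\ L2 D w, weak_div D v w &
    exists phi : nat -> E -> E,
      [/\ forall m i, test_fun D (component (phi m) i),
          forall i, L2norm D (fun x => component (phi m) i x - component v i x)
                      @[m --> \oo] --> 0%E
        & L2norm D (fun x => divergence (phi m) x - w x) @[m --> \oo] --> 0%E]].

(* Polynomial functions of total degree at most m; [mpoly.msize] is the total
   degree plus one. *)
Definition is_poly (m : nat) f : Prop :=
  exists2 p : mpoly.mpoly d R, (mpoly.msize p <= m.+1)%N &
    forall x, f x = mpoly.meval (x ord0) p.

Definition is_polyv (m : nat) v : Prop := forall i, is_poly m (component v i).

End calculus.

(** * Domains and simplicial meshes *)

(* Near each boundary point, after a rigid motion, the domain is the set of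
   points that lie above the graph of a Lipschitz function. *)
Definition lipschitz_domain (R : realType) n (Omega : set 'rV[R]_n.+1) : Prop :=
  [/\ open Omega, connected Omega, Omega !=set0, bounded_set Omega &
    forall x, (closure Omega `\` Omega) x ->
      exists (Q : 'M[R]_n.+1) (gam : 'rV[R]_n -> R) (U : set 'rV[R]_n.+1),
        [/\ Q *m Q^T = 1%:M, lipschitz gam, nbhs x U &
          forall y, U y ->
            (Omega y <-> gam (col' ord0 (y *m Q)) < (y *m Q) ord0 ord0)]].

(* A cell of a mesh of R^(n+1) is the set of its n+2 vertices. *)
Record mesh (R : realType) (n : nat) := Mesh {
  vertex : finType;
  pos : vertex -> 'rV[R]_n.+1;
  cells : {set {set vertex}}
}.

Section mesh.
Variables (R : realType) (n : nat).
Notation E := 'rV[R]_n.+1.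
Variable K : mesh R n.
Notation V := (vertex K).
Implicit Types (S T F : {set V}) (x y : E) (D : set E).

Definition hull S : set E :=
  [set x | exists c : V -> R, [/\ forall a, 0 <= c a, \sum_(a in S) c a = 1
                                & x = \sum_(a in S) c a *: pos a]].

Definition affinely_independent S : Prop :=
  forall c : V -> R, \sum_(a in S) c a = 0 ->
    \sum_(a in S) c a *: pos a = 0 -> forall a, a \in S -> c a = 0.

Definition triangulates D : Prop :=
  [/\ forall T, T \in cells K -> #|T| = n.+2 /\ affinely_independent T,
      closure D = \bigcup_(T in [set` cells K]) hull T
    & forall S T, S \in cells K -> T \in cells K ->
        hull S `&` hull T = hull (S :&: T)].

Definition mesh_size : R := \big[Num.max/0]_(T in cells K) diam (hull T).

Definition shape_regular (sigma : R) : Prop :=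
  forall T, T \in cells K -> diam (hull T) <= sigma * inradius (hull T).

Definition quasi_uniform (tau : R) : Prop :=
  forall T, T \in cells K -> mesh_size <= tau * diam (hull T).

Definition faces : {set {set V}} :=
  [set F : {set V} | (#|F| == n.+1) && [exists T in cells K, F \subset T]].

Definition boundary_face D F : Prop := hull F `<=` closure D `\` D.

Definition unit_normal F (nu : E) : Prop :=
  enorm nu = 1 /\ forall a b, a \in F -> b \in F -> dotv nu (pos a - pos b) = 0.

Definition outward_normal T F : E :=
  xget 0 [set nu | unit_normal F nu /\
    forall a b, a \in T :\: F -> b \in F -> dotv nu (pos a - pos b) < 0].

(** Integrals over faces and over boundaries of cells *)

Definition ref_simplex : set 'rV[R]_n :=
  [set t | (forall i, 0 <= t ord0 i) /\ \sum_i t ord0 i <= 1].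

Definition face_point F (i : nat) : E := nth 0 [seq pos a | a <- enum F] i.

Definition face_edges F : 'M[R]_(n, n.+1) :=
  \matrix_(i < n) (face_point F i.+1 - face_point F 0).

(* Surface integral through the affine parametrization of the face by the
   reference simplex; the Gram determinant gives the area element. *)
Definition face_int F (f : E -> R) : R :=
  Num.sqrt (\det (face_edges F *m (face_edges F)^T)) *
  \int[leb R n]_(t in ref_simplex) f (face_point F 0 + t *m face_edges F).

Definition bdry_int T (f : {set V} -> E -> R) : R :=
  \sum_(a in T) face_int (T :\ a) (f (T :\ a)).

(** * Finite element spaces *)

(* A piecewise polynomial function is given by the family of its restrictions
   to the cells; [broken v] is the corresponding almost everywhere defined
   function, set to 0 outside of the interiors of the cells. *)
Definition broken (W : nmodType) (v : {set V} -> E -> W) : E -> W :=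
  fun x => \sum_(T in cells K | `[< interior (hull T) x >]) v T x.

Implicit Types (u v uh vh : {set V} -> E -> E) (rho lam : {set V} -> E -> R).

Definition in_Vh D k v : Prop :=
  (forall T, T \in cells K -> is_polyv k (v T)) /\ H0div D (broken v).

Definition in_Vhat D (nF : {set V} -> E) k vh : Prop :=
  forall F, F \in faces ->
    [/\ exists2 p : E -> E, is_polyv k p & {in hull F, vh F =1 p},
        forall x, hull F x -> dotv (vh F x) (nF F) = 0
      & boundary_face D F -> forall x, hull F x -> vh F x = 0].

Definition in_Qh k lam : Prop :=
  forall T, T \in cells K -> is_poly k.-1 (lam T).

(** * The scheme *)

Definition a_h (nu alpha : R) (k : nat) u uh v vh : R :=
  nu * \sum_(T in cells K)
    (\int[leb R n.+1]_(x in hull T) frob (gradv (u T) x) (gradv (v T) x)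
     + bdry_int T (fun F x => let nrm := outward_normal T F in
         dotv (gradvn (u T) nrm x) (tang nrm (vh F x - v T x)))
     + bdry_int T (fun F x => let nrm := outward_normal T F in
         dotv (gradvn (v T) nrm x) (tang nrm (uh F x - u T x)))
     + alpha * k%:R ^+ 2 / mesh_size *
       bdry_int T (fun F x => let nrm := outward_normal T F in
         dotv (tang nrm (uh F x - u T x)) (tang nrm (vh F x - v T x)))).

Definition neighbor T F : option {set V} :=
  [pick T' in cells K | (T' != T) && (F \subset T')].

(* On boundary faces, where the normal component of u vanishes, the value
   from inside is taken. *)
Definition upwind rho u T F : E -> R := fun x =>
  if 0 <= dotv (u T x) (outward_normal T F) then rho T x
  else if neighbor T F is Some T' then rho T' x else rho T x.

Definition c_h rho u lam : R :=
  \sum_(T in cells K)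
    (- ipv (hull T) (fun x => rho T x *: u T x) (grad (lam T))
     + bdry_int T (fun F x =>
         dotv (u T x) (outward_normal T F) * upwind rho u T F x * lam T x)).

(* Coercivity on V_h x \hat V_h for the discrete H^1 norm *)
Definition coercive D nF (nu alpha : R) (k : nat) : Prop :=
  exists2 beta : R, 0 < beta &
    forall v vh, in_Vh D k v -> in_Vhat D nF k vh ->
      beta * \sum_(T in cells K)
        (\int[leb R n.+1]_(x in hull T) frob (gradv (v T) x) (gradv (v T) x)
         + mesh_size^-1 *
           bdry_int T (fun F x =>
             enorm (tang (outward_normal T F) (vh F x - v T x)) ^+ 2))
      <= a_h nu alpha k v vh v vh.

Definition eos (cM r : R) : R := cM * r.

Definition solves_scheme D nF (k : nat) (nu alpha cM M : R) (f g : E -> E)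
    u uh rho : Prop :=
  [/\ in_Vh D k u, in_Vhat D nF k uh & in_Qh k rho] /\
  [/\ forall v vh, in_Vh D k v -> in_Vhat D nF k vh ->
        a_h nu alpha k u uh v vh
        - ip D (fun x => eos cM (broken rho x)) (broken (fun T => divergence (v T)))
        = ipv D f (broken v) + ipv D g (fun x => broken rho x *: broken v x),
      forall lam, in_Qh k lam -> c_h rho u lam = 0
    & ip D (broken rho) (fun=> 1) = M].

(** * Gradient-robustness *)

Definition admissible D (cM M : R) (q : E -> R) : Prop :=
  exists C : R,
    {ae leb R n.+1, forall x, D x -> 0 <= (q x - C) / cM} /\
    ip D (fun x => (q x - C) / cM) (fun=> 1) = M.

Definition gradient_robust D nF (k : nat) (nu alpha cM M : R) : Prop :=
  forall f g : E -> E, L2v D f -> Linftyv D g ->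
    {ae leb R n.+1, forall x, D x -> g x = 0} ->
    (exists2 q : E -> R, H1_grad D q f & admissible D cM M q) ->
    exists2 rho, in_Qh k rho &
      solves_scheme D nF k nu alpha cM M f g
        (fun _ _ => 0) (fun _ _ => 0) rho.

End mesh.

(* Main.v *)
(** With zero velocity only the pressure term survives, so hydrostatic balance
    asks for a piecewise polynomial [rho_h] with
    [- (cM rho_h, div v_h) = (f, v_h)] for all [v_h] in [V_h].  Since [v_h] is a
    limit in [H(div)] of compactly supported smooth fields and [f] is the weak
    gradient of [q], [(f, v_h) = - (q - C, w)], where [w] is the weak divergence of
    [v_h]; moreover [w] is almost everywhere the cellwise divergence of [v_h],
    which is piecewise of degree at most [k - 1].  Hence the cellwise
    [L^2] projection of [(q - C) / cM] onto degree [k - 1] is the required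
    density, and testing it against 1 gives the total mass.

    To see that [w] is the cellwise divergence, the smooth approximations are
    tested on a box [B] contained in a cell against the polynomials
    [prod_i (1 - t_i ^ (2 N))], where [t_i] is the affine coordinate mapping
    the [i]-th side of [B] onto [-1 .. 1].  They vanish on the boundary of [B], so
    that integration by parts applies, and they increase to the indicator of
    [B] as [N] grows.  So [w] and the cellwise divergence have the same integral
    over all boxes contained in a cell. *)

Require Import Defs.
From mathcomp Require Import all_boot all_order all_algebra.
From mathcomp Require mpoly.
Import -(notations) mpoly.
From mathcomp Require Import all_classical all_reals all_analysis.
From mathcomp Require Import measurable_realfun ring lra.

Set Implicit Arguments.
Unset Strict Implicit.
Unset Printing Implicit Defensive.

Import Order.TTheory GRing.Theory Num.Theory.
Import numFieldNormedType.Exports.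

Local Open Scope classical_set_scope.
Local Open Scope ring_scope.

(** * Boxes and Borel sets *)

Definition box (R : realType) d (a b : 'rV[R]_d) : set 'rV[R]_d :=
  [set x | forall i, a ord0 i < x ord0 i < b ord0 i].

Section measurability.
Variables (R : realType) (d : nat).
Implicit Types (U : set 'rV[R]_d) (a b : 'rV[R]_d).

Lemma measurable_box a b : measurable (box a b).
Proof.
rewrite (_ : box a b = \bigcap_(i : 'I_d)
    ((fun v : 'rV[R]_d => v ord0 i) @^-1` `]a ord0 i, b ord0 i[)); last first.
  apply/seteqP; split => x /= h; first by move=> i _ /=; rewrite in_itv/=; exact: h.
  by move=> i; have := h i I; rewrite /= in_itv.
apply: fin_bigcap_measurable => // i _.
rewrite -[X in measurable X]setTI; apply: measurable_coor => //.
Qed.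

Lemma box_setI a b a' b' :
  box a b `&` box a' b' =
  box (\row_i Num.max (a ord0 i) (a' ord0 i)) (\row_i Num.min (b ord0 i) (b' ord0 i)).
Proof.
apply/seteqP; split => x /=.
  by move=> [h h'] i; have /andP[? ?] := h i; have /andP[? ?] := h' i;
    rewrite !mxE gt_max lt_min; apply/andP; split; apply/andP.
by move=> h; split=> i; have := h i; rewrite !mxE gt_max lt_min =>
  /andP[/andP[? ?] /andP[? ?]]; apply/andP.
Qed.

(** The balls of the sup norm are boxes, and density of the rationals allows rational corners. Only
    countably many boxes are then needed, both for measurability of open sets and for gluing almost
    everywhere statements. *)
Lemma open_nbhs_ratr_box U x : open U -> U x ->
  exists2 pq : 'rV[rat]_d * 'rV[rat]_d,
    box (map_mx ratr pq.1) (map_mx ratr pq.2) `<=` U &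
    box (map_mx ratr pq.1) (map_mx ratr pq.2) x.
Proof.
move=> oU Ux; have /nbhs_ballP[e /= e0 eU] : nbhs x U by exact: open_nbhs_nbhs.
have lo i : exists p : rat, x ord0 i - e < ratr p < x ord0 i.
  have /rat_in_itvoo[p] : x ord0 i - e < x ord0 i by rewrite ltrBlDr ltrDl.
  by rewrite in_itv/= => ?; exists p.
have hi i : exists p : rat, x ord0 i < ratr p < x ord0 i + e.
  have /rat_in_itvoo[p] : x ord0 i < x ord0 i + e by rewrite ltrDl.
  by rewrite in_itv/= => ?; exists p.
have [p hp] := choice lo; have [q hq] := choice hi.
exists (\row_i p i, \row_i q i) => /= [y yb|i].
  apply: eU; split => // i j; rewrite [i]ord1 /ball/= ltr_norml.
  have := yb j; rewrite !mxE => /andP[h1 h2].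
  have /andP[h3 _] := hp j; have /andP[_ h4] := hq j.
  by apply/andP; split; lra.
by rewrite !mxE; have /andP[_ ->] := hp i; have /andP[-> _] := hq i.
Qed.

Lemma open_bigcup_box U : open U ->
  U = \bigcup_(pq : 'rV[rat]_d * 'rV[rat]_d)
    (if `[< box (map_mx ratr pq.1) (map_mx ratr pq.2) `<=` U >]
     then box (map_mx ratr pq.1) (map_mx ratr pq.2) else set0).
Proof.
move=> oU; apply/seteqP; split => [x Ux|x [pq _]].
  have [pq pqU pqx] := open_nbhs_ratr_box oU Ux.
  by exists pq => //; case: asboolP.
by case: asboolP => // + ?; exact.
Qed.

(** The sigma-algebra is generated by the coordinates, so open sets enter it only through countable
    unions of boxes. *)
Lemma open_rV_measurable U : open U -> measurable U.
Proof.
move=> /open_bigcup_box ->; apply: countable_bigcupT_measurable => // pq.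
by case: asboolP => // _; exact: measurable_box.
Qed.

Lemma continuous_rV_measurable (f : 'rV[R]_d -> R) : continuous f ->
  measurable_fun [set: 'rV[R]_d] (f : _ -> measurableTypeR R).
Proof.
move=> cf; apply: (measurability _ (RGenOpens.measurableE R)) => _ [_ [a [b ->]] <-].
rewrite setTI; apply: open_rV_measurable.
by apply: open_comp => // x _; exact: cf.
Qed.

Definition boxes : set (set 'rV[R]_d) := [set A | exists a b, A = box a b].

Lemma open_g_boxes U : open U -> (<<s boxes >>) U.
Proof.
move=> /open_bigcup_box ->.
apply: (@countable_bigcupT_measurable _ (g_sigma_algebraType boxes)) => // pq.
case: asboolP => _; last exact: (@measurable0 _ (g_sigma_algebraType boxes)).
by apply: sub_sigma_algebra; eexists; eexists.
Qed.

(** A coordinate pulls open sets back to open sets, which are countable unions of boxes. With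
    [boxes_setI] this makes the boxes a generating pi-system, as Dynkin's argument requires. *)
Lemma measurable_boxesE : @measurable _ 'rV[R]_d = <<s boxes >>.
Proof.
apply/seteqP; split; last first.
  apply: smallest_sub; first exact: sigma_algebra_measurable.
  by move=> _ [a [b ->]]; exact: measurable_box.
apply: smallest_sub; first exact: smallest_sigma_algebra.
move=> A; rewrite -bigcup_seq => -[i _ /= [D mD <-]].
pose T' : measurableType _ := g_sigma_algebraType boxes.
suff h : measurable_fun [set: T'] (fun v : 'rV[R]_d => v ord0 i : measurableTypeR R).
  exact: h.
apply: (measurability _ (RGenOpens.measurableE R)) => _ [_ [a [b ->]] <-].
rewrite setTI; apply: open_g_boxes.
by apply: open_comp => // x _; exact: coord_continuous.
Qed.

Lemma boxes_setI : setI_closed boxes.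
Proof. by move=> _ _ [a [b ->]] [a' [b' ->]]; rewrite box_setI; eexists; eexists. Qed.

End measurability.

(** * Integration by parts on boxes *)

Lemma rV_cons_ball (R : realType) n (p q : R * 'rV[R]_n) e :
  ball p.1 e q.1 -> ball p.2 e q.2 -> ball (rV_cons p) e (rV_cons q).
Proof.
move=> h1 [e0 h2]; split => // i j; rewrite [i]ord1.
have [k ->|->] := unliftP ord0 j; first by rewrite !rV_consS; exact: h2.
by rewrite !rV_cons0.
Qed.

Lemma continuous_rV_consr (R : realType) n (x : R) :
  continuous (fun y : 'rV[R]_n => rV_cons (x, y)).
Proof.
move=> y A /nbhs_ballP[e /= e0 eA]; apply/nbhs_ballP; exists e => // z yz.
by apply: eA; apply: rV_cons_ball => //; exact: ballxx.
Qed.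

Lemma continuous_rV_consl (R : realType) n (y : 'rV[R]_n) :
  continuous (fun x : R => rV_cons (x, y)).
Proof.
move=> x A /nbhs_ballP[e /= e0 eA]; apply/nbhs_ballP; exists e => // z xz.
by apply: eA; apply: rV_cons_ball => //; exact: ballxx.
Qed.

(** A directional derivative depends only on the values along one line. The two functions may live
    on different spaces, so partial derivatives pass to slices of lower dimension. *)
Lemma is_derive_shift (K : numFieldType) (V V' W : normedModType K) (f : V -> W)
    (g : V' -> W) x v y w df :
  (forall h : K, f (h *: v + x) = g (h *: w + y)) ->
  is_derive x v f df -> is_derive y w g df.
Proof.
move=> fg [dx Dx].
have E : (fun h : K => h^-1 *: ((f \o shift x) (h *: v) - f x)) =
         (fun h : K => h^-1 *: ((g \o shift y) (h *: w) - g y)).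
  apply/funext => h; rewrite /= fg; congr (_ *: (_ - _)).
  by have := fg 0; rewrite !scale0r !add0r.
split; first by move: dx; rewrite /derivable E.
by rewrite -Dx /derive E.
Qed.

Section leb.
Variable R : realType.

Lemma rV_cons_box n (a b : 'rV[R]_n.+1) :
  @rV_cons R n @^-1` box a b =
  `]a ord0 ord0, b ord0 ord0[ `*`
  box (\row_i a ord0 (lift ord0 i)) (\row_i b ord0 (lift ord0 i)).
Proof.
apply/seteqP; split => -[x y] /=.
  move=> h; split; first by have := h ord0; rewrite rV_cons0/= in_itv.
  by move=> i; have := h (lift ord0 i); rewrite rV_consS/= !mxE.
move=> [h1 h2] i; have [k ->|->] := unliftP ord0 i.
  by rewrite rV_consS/=; have := h2 k; rewrite !mxE.
by rewrite rV_cons0/=; rewrite in_itv/= in h1.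
Qed.

Lemma leb_box_lty n (a b : 'rV[R]_n) : (leb R n (box a b) < +oo)%E.
Proof.
elim: n a b => [|n IH] a b.
  by rewrite /= diracE ltry.
rewrite /= /leb_step /pushforward rV_cons_box product_measure1E//; last first.
  exact: measurable_box.
by apply: lte_mul_pinfty => //=; rewrite lebesgue_measure_itv/=;
  case: ifPn => // _; rewrite -EFinD ltry.
Qed.

(** The closed box is compact as a product of segments. *)
Lemma continuous_bounded_box n (g : 'rV[R]_n -> R) a b : continuous g ->
  exists M, forall x, box a b x -> `|g x| <= M.
Proof.
move=> cg.
have cK : compact [set v : 'rV[R]_n | forall i, `[a ord0 i, b ord0 i]%classic (v ord0 i)].
  by apply: (@rV_compact R n (fun i => `[a ord0 i, b ord0 i]%classic)) => i;
    exact: segment_compact.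
have /compact_bounded[M [_ hM]] : compact (g @` [set v : 'rV[R]_n |
     forall i, `[a ord0 i, b ord0 i]%classic (v ord0 i)]).
  by apply: continuous_compact => //; apply: continuous_subspaceT.
exists (M + 1) => x xab; apply: hM; first by rewrite ltrDl.
exists x => // i /=; rewrite in_itv/=.
by have /andP[/ltW-> /ltW->] := xab i.
Qed.

Lemma continuous_integrable_box n (g : 'rV[R]_n -> R) a b : continuous g ->
  (leb R n).-integrable (box a b) (EFin \o g).
Proof.
move=> cg; apply: measurable_bounded_integrable.
- exact: measurable_box.
- exact: leb_box_lty.
- by apply: measurable_funTS; exact: continuous_rV_measurable.
- have [M hM] := continuous_bounded_box a b cg.
  exists M; split; first exact: num_real.
  by move=> y My x /= xab; apply: le_trans (ltW My); exact: hM.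
Qed.

Section fubini.
Variables (n : nat) (f : 'rV[R]_n.+1 -> \bar R).
Hypothesis fi : (leb R n.+1).-integrable setT f.
Let mu1 := @lebesgue_measure R.

Lemma integrable_rV_cons :
  (mu1 \x leb R n)%E.-integrable setT (f \o @rV_cons R n).
Proof.
have mf : measurable_fun [set: 'rV[R]_n.+1] f := measurable_int _ fi.
move/integrableP : fi => [_ foo]; apply/integrableP; split.
  by apply: measurableT_comp; [exact: mf|exact: measurable_rV_cons].
move: foo; rewrite /= /leb_step ge0_integral_pushforward//; last first.
  exact: measurableT_comp.
exact: measurable_rV_cons.
Qed.

(** The two orders of integration are both needed: the recursive measure splits off the first
    coordinate, which is integrated last here and first in [leb_fubini2]. *)
Lemma leb_fubini1 : (\int[leb R n.+1]_z f z =
  \int[mu1]_x \int[leb R n]_y f (rV_cons (x, y)))%E.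
Proof.
rewrite /= /leb_step integral_pushforward//.
- by rewrite -integral12_prod_meas1//; exact: integrable_rV_cons.
- exact: measurable_rV_cons.
- exact: (measurable_int _ fi).
- exact: integrable_rV_cons.
Qed.

Lemma leb_fubini2 : (\int[leb R n.+1]_z f z =
  \int[leb R n]_y \int[mu1]_x f (rV_cons (x, y)))%E.
Proof.
rewrite /= /leb_step integral_pushforward//.
- by rewrite -integral21_prod_meas1//; exact: integrable_rV_cons.
- exact: measurable_rV_cons.
- exact: (measurable_int _ fi).
- exact: integrable_rV_cons.
Qed.

End fubini.

(** By Fubini this reduces to the fundamental theorem of calculus along the [i]-th axis, by
    induction on the dimension. *)
Lemma integral_box_derive n (i : 'I_n) (a b : 'rV[R]_n) (G g : 'rV[R]_n -> R) :
  continuous g ->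
  (forall x, is_derive x (delta_mx ord0 i) G (g x)) ->
  (forall x : 'rV[R]_n, x ord0 i = a ord0 i \/ x ord0 i = b ord0 i -> G x = 0) ->
  (\int[leb R n]_(x in box a b) (g x)%:E = 0)%E.
Proof.
elim: n i a b G g => [[]//|n IH] i a b G g cg Gg G0.
rewrite integral_mkcond.
have fi : (leb R n.+1).-integrable setT ((EFin \o g) \_ (box a b)).
  apply/(integrable_mkcond _ _).1; first exact: measurable_box.
  exact: continuous_integrable_box.
have boxE x y : box a b (rV_cons (x, y)) <-> `]a ord0 ord0, b ord0 ord0[%classic x /\
     box (\row_i a ord0 (lift ord0 i)) (\row_i b ord0 (lift ord0 i)) y.
  by rewrite -/(_ (x, y)) -[_ /\ _]/((_ `*` _) (x, y)) -rV_cons_box.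
have [j ij|i0] := unliftP ord0 i.
(* The differentiated coordinate is not the first one: the first is frozen and the induction
   hypothesis kills every slice. *)
- rewrite leb_fubini1//; apply: integral0_eq => x _.
  have [xab|xab] := pselect (`]a ord0 ord0, b ord0 ord0[%classic x); last first.
    apply: integral0_eq => y _; rewrite patchE; case: ifPn => //.
    by rewrite inE boxE => -[].
  pose a' : 'rV[R]_n := \row_i a ord0 (lift ord0 i).
  pose b' : 'rV[R]_n := \row_i b ord0 (lift ord0 i).
  rewrite (_ : (fun y => _) = (EFin \o (fun y => g (rV_cons (x, y)))) \_ (box a' b')).
    rewrite -integral_mkcond.
    apply: (IH j a' b' (fun y => G (rV_cons (x, y)))).
    + move=> y; apply: continuous_comp; first exact: continuous_rV_consr.
      exact: cg.
    + move=> y; apply: is_derive_shift (Gg (rV_cons (x, y))) => h.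
      congr G; apply/rowP => k; rewrite ij.
      have [l ->|->] := unliftP ord0 k.
        by rewrite rV_consS [LHS]mxE rV_consS/= !mxE eqxx/= (inj_eq (@lift_inj _ ord0)).
      by rewrite rV_cons0 [LHS]mxE rV_cons0/= !mxE eqxx/= mulr0 add0r.
    + by move=> y; rewrite !mxE => h; apply: G0; rewrite ij rV_consS.
  apply/funext => y; rewrite !patchE; congr (if _ then _ else _).
  by apply/idP/idP; rewrite !inE => h; [have := (boxE _ _).1 h; case|apply/boxE].
(* The differentiated coordinate is the first one: it is integrated innermost, where [G] takes equal
   values at both ends. *)
- rewrite leb_fubini2//; apply: integral0_eq => y _.
  pose a' : 'rV[R]_n := \row_i a ord0 (lift ord0 i).
  pose b' : 'rV[R]_n := \row_i b ord0 (lift ord0 i).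
  have [yab|yab] := pselect (box a' b' y); last first.
    apply: integral0_eq => x _; rewrite patchE; case: ifPn => //.
    by rewrite inE boxE => -[].
  pose gy (x : R) := g (rV_cons (x, y)); pose Gy (x : R) := G (rV_cons (x, y)).
  have cgy : continuous gy.
    move=> x; apply: continuous_comp; first exact: continuous_rV_consl.
    exact: cg.
  rewrite (_ : (fun y => _) = (EFin \o gy) \_ `]a ord0 ord0, b ord0 ord0[); last first.
    apply/funext => x; rewrite !patchE; congr (if _ then _ else _).
    by apply/idP/idP; rewrite !inE => h; [have := (boxE _ _).1 h; case|apply/boxE].
  rewrite -integral_mkcond.
  have [ab|ba] := ltP (a ord0 ord0) (b ord0 ord0); last first.
    by rewrite set_itv_ge ?integral_set0// bnd_simp -leNgt.
  have dGy (x : R) : is_derive x (1 : R) Gy (gy x).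
    apply: is_derive_shift (Gg (rV_cons (x, y))) => h.
    congr G; apply/rowP => k; rewrite i0.
    have [l ->|->] := unliftP ord0 k.
      by rewrite rV_consS [LHS]mxE rV_consS/= !mxE mulr0 add0r.
    by rewrite rV_cons0 [LHS]mxE rV_cons0/= !mxE eqxx/=.
  have cGy : continuous Gy.
    by move=> x; apply: differentiable_continuous; apply/derivable1_diffP; case: (dGy x).
  (* The endpoints are null, so the open interval may be closed before the fundamental theorem is
     applied. *)
  rewrite -(integral_itv_bndoo true false); last first.
    apply/measurable_EFinP; apply: measurable_funTS.
    exact: continuous_measurable_fun.
  rewrite (continuous_FTC2 (F := Gy))//.
  + by rewrite /Gy !G0 ?subee//; rewrite i0 rV_cons0; [left|right].
  + exact: continuous_subspaceT.
  + split.
    * by move=> x _; case: (dGy x).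
    * by apply: cvg_at_right_filter; exact: cGy.
    * by apply: cvg_at_left_filter; exact: cGy.
  + by move=> x _; rewrite derive1E; case: (dGy x).
Qed.

End leb.

(** Induction on the dimension. If all coefficients but the first vanish, the hyperplane is a point
    times the whole remaining space; otherwise each slice at a fixed first coordinate is a
    hyperplane one dimension lower. *)
Lemma leb_hyperplane (R : realType) n (c : R) (a : 'rV[R]_n) : a != 0 ->
  leb R n [set x | c + dotv a x = 0] = 0%E.
Proof.
have mH m (c' : R) (a' : 'rV[R]_m) :
    measurable (([set x | c' + dotv a' x = 0]) : set 'rV[R]_m).
  rewrite [X in measurable X](_ : _ = (fun x => c' + dotv a' x) @^-1` [set 0])//.
  rewrite -[X in measurable X]setTI.
  apply: (_ : measurable_fun setT (fun x : 'rV[R]_m => c' + dotv a' x)) => //.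
  apply: measurable_funD => //; apply: measurable_sum => i.
  by apply: measurable_funM => //; exact: measurable_coor.
elim: n c a => [c a|n IH c a a0].
  by move=> /eqP; case; apply/rowP => -[].
have dotS x (y : 'rV[R]_n) : dotv a (rV_cons (x, y)) =
    a ord0 ord0 * x + dotv (\row_i a ord0 (lift ord0 i)) y.
  rewrite /dotv big_ord_recl rV_cons0/=; congr (_ + _).
  by apply: eq_bigr => i _; rewrite rV_consS mxE.
rewrite /= /leb_step /pushforward.
have [a'0|a'0] := eqVneq (\row_i a ord0 (lift ord0 i) : 'rV[R]_n) 0.
  have a00 : a ord0 ord0 != 0.
    apply: contra_neq a0 => a00; apply/rowP => i; rewrite mxE.
    have [j ->|->//] := unliftP ord0 i.
    by have := congr1 (fun M : 'rV[R]_n => M ord0 j) a'0; rewrite !mxE.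
  rewrite (_ : _ @^-1` _ = [set - (c / a ord0 ord0)] `*` setT).
    rewrite product_measure1E//; first by rewrite /= lebesgue_measure_set1 mul0e.
  apply/seteqP; split => -[x y] /=; rewrite dotS a'0 /dotv big1 ?addr0;
    [|by move=> i _; rewrite mxE mul0r| |by move=> i _; rewrite mxE mul0r].
    move=> /eqP; rewrite addrC addr_eq0 => /eqP h; split => //.
    by apply: (mulfI a00); rewrite h mulrN mulrC divfK.
  by move=> [-> _]; rewrite mulrN mulrC divfK// subrr.
rewrite /product_measure1 integral0_eq// => x _ /=.
rewrite -[RHS](IH (c + a ord0 ord0 * x) _ a'0); congr (leb R n _).
apply/seteqP; split => y; rewrite /xsection/= inE/= dotS addrA//.
Qed.

(** * Square-integrable functions *)

Section L2.
Variables (R : realType) (d : nat) (D : set 'rV[R]_d).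
Hypothesis mD : measurable D.
Let mu := leb R d.
Local Notation inte f := (mu.-integrable D (EFin \o f)).
Implicit Types f g h : 'rV[R]_d -> R.

(** Replaces the extension by zero and the real power in the library's norm by a condition on [D]
    with an ordinary square. *)
Lemma L2P f : L2 D f <-> measurable_fun D f /\ inte (fun x => f x ^+ 2).
Proof.
have sqE : EFin \o (fun x => (f \_ D) x ^+ 2) = (EFin \o (fun x => f x ^+ 2)) \_ D.
  by apply/funext => x /=; rewrite !patchE; case: ifPn => //; rewrite expr0n.
split=> [fL2|[mf fi]].
  split; last first.
    by apply/(integrable_mkcond _ mD); rewrite -sqE; exact: Lfun2_integrable_sqr.
  apply/(measurable_restrictT f mD); move: fL2; rewrite /L2 inE => /andP[fm _]; move: fm.
  by rewrite inE.
have mfD : measurable_fun [set: 'rV[R]_d] (f \_ D) by exact/(measurable_restrictT f mD).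
rewrite /L2 inE; apply/andP; split; rewrite inE//= /finite_norm unlock.
apply: poweR_lty; move/(integrable_mkcond _ mD) : fi; rewrite -sqE.
move=> /integrableP[_]; apply: le_lt_trans.
apply: ge0_le_integral => //=.
- apply/measurable_EFinP.
  apply/(@measurableT_comp _ _ _ _ _ _ (fun x : R => x `^ 2)%R) => //.
  exact/measurableT_comp.
- apply/measurable_EFinP; apply: measurableT_comp => //.
  exact: measurable_funX.
- by move=> x _; rewrite lee_fin normrX powR_mulrn.
Qed.

Let inteD f g : inte f -> inte g -> inte (fun x => f x + g x).
Proof. by move=> hf hg; exact: (integrableD mD hf hg). Qed.

(** The majorant [f ^+ 2 + g ^+ 2] comes from expanding the square of [|f| - |g|]. *)
Lemma L2_mul f g : L2 D f -> L2 D g -> inte (fun x => f x * g x).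
Proof.
move=> /L2P[mf fi] /L2P[mg gi].
apply: (@le_integrable _ _ _ _ _ mD _
    (EFin \o (fun x => f x ^+ 2 + g x ^+ 2))).
- by apply/measurable_EFinP; exact: measurable_funM.
- move=> x _ /=; rewrite lee_fin (ger0_norm (addr_ge0 (sqr_ge0 _) (sqr_ge0 _))).
  rewrite normrM -(real_normK (num_real (f x))) -(real_normK (num_real (g x))).
  set a := `|f x|; set b := `|g x|.
  have := sqr_ge0 (a - b); have : 0 <= a * b by apply: mulr_ge0; exact: normr_ge0.
  by rewrite sqrrB; lra.
- exact: inteD.
Qed.

Lemma L2D f g : L2 D f -> L2 D g -> L2 D (fun x => f x + g x).
Proof.
move=> hf hg; have fg := L2_mul hf hg.
move/L2P : hf => [mf fi]; move/L2P : hg => [mg gi]; apply/L2P; split.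
  exact: measurable_funD.
rewrite (_ : (fun x => _) =
    fun x => f x ^+ 2 + (f x * g x + f x * g x) + g x ^+ 2).
  by apply: inteD => //; apply: inteD => //; exact: inteD.
by apply/funext => x; rewrite sqrrD mulr2n.
Qed.

Lemma L2Z c f : L2 D f -> L2 D (fun x => c * f x).
Proof.
move=> /L2P[mf fi]; apply/L2P; split; first exact: measurable_funM.
rewrite (_ : _ \o _ = fun x => ((c ^+ 2)%:E * (f x ^+ 2)%R%:E)%E).
  exact: integrableZl.
by apply/funext => x /=; rewrite -EFinM exprMn.
Qed.

Lemma L2B f g : L2 D f -> L2 D g -> L2 D (fun x => f x - g x).
Proof.
move=> hf hg; have := L2D hf (L2Z (-1) hg).
by congr (L2 D _); apply/funext => x; rewrite mulN1r.
Qed.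

Lemma L2_sum (I : Type) (s : seq I) (P : pred I) (F : I -> 'rV[R]_d -> R) :
  L2 D (cst 0) -> (forall i, P i -> L2 D (F i)) ->
  L2 D (fun x => \sum_(i <- s | P i) F i x).
Proof.
move=> h0 hF; elim: s => [|i s IH].
  by rewrite (_ : (fun _ => _) = cst 0)//; apply/funext => x; rewrite big_nil.
case: (boolP (P i)) => Pi.
  rewrite (_ : (fun _ => _) = fun x => F i x + \sum_(i <- s | P i) F i x).
    by apply: L2D => //; exact: hF.
  by apply/funext => x; rewrite big_cons Pi.
rewrite (_ : (fun _ => _) = fun x => \sum_(i <- s | P i) F i x)//.
by apply/funext => x; rewrite big_cons (negbTE Pi).
Qed.

Lemma L2_bounded f M : (mu D < +oo)%E -> measurable_fun D f ->
  (forall x, D x -> `|f x| <= M) -> L2 D f.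
Proof.
move=> Doo mf fM; apply/L2P; split => //.
apply: measurable_bounded_integrable => //; first exact: measurable_funX.
exists (M ^+ 2); split; first exact: num_real.
move=> y My x /= Dx; apply: le_trans (ltW My).
by rewrite normrX lerXn2r// ?nnegrE// ?(le_trans _ (fM _ Dx)).
Qed.

Lemma ipDl f g h : L2 D f -> L2 D g -> L2 D h ->
  ip D (fun x => f x + g x) h = ip D f h + ip D g h.
Proof.
move=> hf hg hh; rewrite /ip -RintegralD//; [|exact: L2_mul..].
by apply: eq_Rintegral => x _; rewrite mulrDl.
Qed.

Lemma ipZl c f g : L2 D f -> L2 D g -> ip D (fun x => c * f x) g = c * ip D f g.
Proof.
move=> hf hg; rewrite /ip -RintegralZl//; last exact: L2_mul.
by apply: eq_Rintegral => x _; rewrite mulrA.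
Qed.

Lemma ipC f g : ip D f g = ip D g f.
Proof. by apply: eq_Rintegral => x _; rewrite mulrC. Qed.

Lemma ipBl f g h : L2 D f -> L2 D g -> L2 D h ->
  ip D (fun x => f x - g x) h = ip D f h - ip D g h.
Proof.
move=> hf hg hh; rewrite /ip -RintegralB//; [|exact: L2_mul..].
by apply: eq_Rintegral => x _; rewrite mulrBl.
Qed.

Lemma ip_suml (I : Type) (s : seq I) (P : pred I) (F : I -> 'rV[R]_d -> R) h :
  L2 D (cst 0) -> L2 D h -> (forall i, P i -> L2 D (F i)) ->
  ip D (fun x => \sum_(i <- s | P i) F i x) h = \sum_(i <- s | P i) ip D (F i) h.
Proof.
move=> h0 hh hF; elim: s => [|i s IH].
  rewrite big_nil /ip (_ : (fun _ => _) = cst 0) ?Rintegral_cst ?mul0r//.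
  by apply/funext => x; rewrite big_nil mul0r.
rewrite big_cons; case: (boolP (P i)) => Pi; rewrite -IH.
  rewrite -ipDl//; [|exact: hF|exact: L2_sum].
  by congr (ip D _ _); apply/funext => x; rewrite big_cons Pi.
by congr (ip D _ _); apply/funext => x; rewrite big_cons (negbTE Pi).
Qed.

(** Hölder's inequality with both exponents 2, applied to the extensions by zero. *)
Lemma cauchy_schwarz_ip f g : L2 D f -> L2 D g ->
  (`|ip D f g|%:E <= L2norm D f * L2norm D g)%E.
Proof.
move=> hf hg; rewrite /ip EFin_normr_Rintegral//; last exact: L2_mul.
apply: (le_trans (le_abse_integral _ mD _)).
  by apply/measurable_EFinP; move/L2P : hf => [? _]; move/L2P : hg => [? _];
    exact: measurable_funM.
have mres h : L2 D h -> measurable_fun [set: 'rV[R]_d] (h \_ D).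
  by move=> /L2P[mh _]; exact/(measurable_restrictT _ mD).
have := @hoelder _ _ _ mu _ _ _ _ (mres _ hf) (mres _ hg) (ltr0n R 2) (ltr0n R 2).
rewrite -div1r -splitr => /(_ erefl); apply: le_trans.
rewrite Lnorm1 integral_mkcond; apply: ge0_le_integral => //=.
- by move=> x _; rewrite patchE; case: ifPn.
- apply/(measurable_restrictT _ mD)/measurable_EFinP; apply: measurableT_comp => //.
  by move/L2P : hf => [? _]; move/L2P : hg => [? _];
    exact: measurable_funM.
- apply/measurable_EFinP; apply: measurableT_comp => //.
  by apply: measurable_funM; exact: mres.
- move=> x _; rewrite !patchE; case: ifPn => //= _; rewrite mul0r normr0//.
Qed.

Lemma L2norm_lty f : L2 D f -> (L2norm D f < +oo)%E.
Proof. by rewrite /L2 inE => /andP[_]; rewrite inE. Qed.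

(** By Cauchy-Schwarz the error is at most the norm of [f_ m - f] times the finite norm of [g]. All
    limits along the approximating fields are taken through this lemma. *)
Lemma cvg_ip (f_ : nat -> 'rV[R]_d -> R) f g :
  (forall m, L2 D (f_ m)) -> L2 D f -> L2 D g ->
  L2norm D (fun x => f_ m x - f x) @[m --> \oo] --> 0%E ->
  ip D (f_ m) g @[m --> \oo] --> ip D f g.
Proof.
move=> hf_ hf hg cf; apply/cvgrPdist_lt => e e0.
have C0 : (0 <= L2norm D g)%E by exact: Lnorm_ge0.
have Cfin : L2norm D g \is a fin_num by rewrite ge0_fin_numE// L2norm_lty.
pose N m := (L2norm D (fun x => f_ m x - f x)%R * L2norm D g)%E.
have Nfin m : N m \is a fin_num.
  by rewrite fin_numM// ge0_fin_numE ?Lnorm_ge0// L2norm_lty//; exact: L2B.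
have : N m @[m --> \oo] --> 0%E by rewrite -(mul0e (L2norm D g)); apply: cvgeZr.
move=> /fine_cvg /cvgrPdist_lt /(_ e e0); apply: filterS => m; apply: le_lt_trans.
rewrite sub0r normrN distrC -ipBl// (le_trans _ (ler_norm _))// -lee_fin fineK//.
by apply: cauchy_schwarz_ip => //; exact: L2B.
Qed.

End L2.

(** * Polynomial functions *)

Section polynomials.
Variables (R : realType) (d : nat).
Notation poly := (mpoly d R).
Implicit Types p q : poly.

Definition peval p : 'rV[R]_d -> R := fun x => meval (x ord0) p.

(** Constants and variables generate the polynomial ring, so analytic facts need checking only on
    these and under sums and products. *)
Lemma mpoly_ring_ind (P : poly -> Prop) :
  (forall c, P (mpolyC d c)) -> (forall i, P (@mpolyX d R (mnm1 i))) ->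
  (forall p q, P p -> P q -> P (p + q)) -> (forall p q, P p -> P q -> P (p * q)) ->
  forall p, P p.
Proof.
move=> PC PX PD PM p; rewrite (mpolyE p).
apply: (big_ind P) => [||m _]; [by rewrite -(mpolyC0 d R)|exact: PD|].
rewrite -mul_mpolyC; apply: (PM) => //; rewrite mpolyXE_id.
apply: (big_ind P) => [||i _]; [by rewrite -(mpolyC1 d R)|exact: PM|].
by elim: (m i) => [|k IH]; [rewrite expr0 -(mpolyC1 d R)|rewrite exprS; exact: PM].
Qed.

(** The regularity shared by polynomials and test functions; integration by parts over a box asks
    for nothing more. *)
Definition C1_fun (f : 'rV[R]_d -> R) : Prop :=
  continuous f /\ forall i, continuous (partial i f) /\
    forall x, is_derive x (delta_mx ord0 i) f (partial i f x).

Lemma continuous_peval p : continuous (peval p).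
Proof.
elim/mpoly_ring_ind : p => [c|i|p q cp cq|p q cp cq] x.
- rewrite (_ : peval _ = cst c); first exact: cst_continuous.
  by apply/funext => y; rewrite /peval mevalC.
- rewrite (_ : peval _ = fun y : 'rV[R]_d => y ord0 i); first exact: coord_continuous.
  by apply/funext => y; rewrite /peval mevalXU.
- rewrite (_ : peval _ = fun y => peval p y + peval q y).
    by apply: continuousD; [exact: cp|exact: cq].
  by apply/funext => y; rewrite /peval mevalD.
- rewrite (_ : peval _ = fun y => peval p y * peval q y).
    by apply: continuousM; [exact: cp|exact: cq].
  by apply/funext => y; rewrite /peval mevalM.
Qed.

Lemma is_derive_peval p i (x : 'rV[R]_d) :
  is_derive x (delta_mx ord0 i) (peval p) (peval (mderiv i p) x).
Proof.
elim/mpoly_ring_ind : p => [c|j|p q dp dq|p q dp dq].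
- rewrite (_ : peval _ = cst c); last by apply/funext => y; rewrite /peval mevalC.
  by rewrite mderivC /peval meval0; exact: is_derive_cst.
- rewrite (_ : peval (@mpolyX _ _ _) = fun y : 'rV[R]_d => y ord0 j); last first.
    by apply/funext => y; rewrite /peval mevalXU.
  have -> : peval (mderiv i (@mpolyX _ R (mnm1 j))) x = (i == j)%:R.
    rewrite mderivX mnm1E /peval mevalZ eq_sym.
    have [->|_] := eqVneq i j; last by rewrite mul0r.
    have -> : mnm_sub (mnm1 j) (mnm1 j) = @mnm0 d by apply/mnmP => k; rewrite mnmBE subnn mnm0E.
    by rewrite mpolyX0 meval1 mulr1.
  (* Along the [i]-th axis the [j]-th coordinate is an affine function of one real variable. *)
  apply: (@is_derive_shift _ _ _ _ (fun t : R => t * (i == j)%:R + x ord0 j) _ 0 1).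
    by move=> h; rewrite !mxE eqxx/= addr0 [_ *: _]mulr1 eq_sym.
  apply: is_derive_eq; rewrite addr0 scaler0 add0r [LHS]mulr1//.
- rewrite (_ : peval (p + q) = peval p + peval q); last first.
    by apply/funext => y; rewrite /peval mevalD.
  by rewrite mderivD {3}/peval mevalD; exact: is_deriveD.
- rewrite (_ : peval (p * q) = fun y => peval p y * peval q y); last first.
    by apply/funext => y; rewrite /peval mevalM.
  have -> : peval (mderiv i (p * q)) x =
      peval p x *: (peval (mderiv i q) x : R^o) + peval q x *: (peval (mderiv i p) x : R^o).
    by rewrite mderivM /peval mevalD !mevalM addrC [X in _ + X]mulrC.
  exact: (is_deriveM dp dq).
Qed.

Lemma partial_peval p i : partial i (peval p) = peval (mderiv i p).
Proof. by apply/funext => x; have [] := is_derive_peval p i x. Qed.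

Lemma C1_peval p : C1_fun (peval p).
Proof.
split=> [|i]; first exact: continuous_peval.
rewrite partial_peval; split; first exact: continuous_peval.
exact: is_derive_peval.
Qed.

Lemma msize_mderiv p i k : (msize p <= k.+1)%N -> (msize (mderiv i p) <= k)%N.
Proof.
move=> pk; rewrite {1}(mpolyE p) raddf_sum /=.
apply: leq_trans; first exact: mmeasure_sum.
apply/bigmax_leqP_seq => m mp _.
rewrite linearZ/= mderivX; apply: (leq_trans (msizeZ_le _ _)).
(* Subtraction of exponents truncates at 0, but then the coefficient [m i] vanishes; otherwise the
   degree drops by one. *)
have [->|mi] := eqVneq (m i) 0%N; first by rewrite scale0r mmeasure0.
apply: (leq_trans (msizeZ_le _ _)); rewrite msizeX.
have := leq_trans (msize_mdeg_lt mp) pk.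
rewrite -{1}(submK (_ : mpoly.lem (mnm1 i) m)) ?mdegD ?mdeg1 ?addn1//.
by rewrite lep1mP.
Qed.

End polynomials.

(** * Weak divergences *)

Section bump.
Variables (R : realType) (d : nat) (a b : 'rV[R]_d).
Hypothesis ab : forall i, a ord0 i < b ord0 i.
Let B := box a b.

Let t i : mpoly d R :=
  mpolyC d (2 / (b ord0 i - a ord0 i)) * @mpolyX d R (mnm1 i)
  - mpolyC d ((a ord0 i + b ord0 i) / (b ord0 i - a ord0 i)).

Definition bump_poly N : mpoly d R := \prod_i (1 - t i ^+ 2 ^+ N).

Let tE i x : peval (t i) x =
  (2 * x ord0 i - (a ord0 i + b ord0 i)) / (b ord0 i - a ord0 i).
Proof.
rewrite /peval /t mevalB mevalM !mevalC mevalXU.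
have := ab i; rewrite -subr_gt0 => /lt0r_neq0 h; by field.
Qed.

Lemma peval_bump N x : peval (bump_poly N) x = \prod_i (1 - peval (t i) x ^+ 2 ^+ N).
Proof.
rewrite /peval rmorph_prod; apply: eq_bigr => i _.
by rewrite rmorphB rmorph1 !rmorphXn.
Qed.

Lemma bump_eq0 N i (x : 'rV[R]_d) :
  x ord0 i = a ord0 i \/ x ord0 i = b ord0 i -> peval (bump_poly N) x = 0.
Proof.
move=> h; rewrite peval_bump (bigD1 i)//= (_ : peval (t i) x ^+ 2 = 1).
  by rewrite expr1n subrr mul0r.
have := ab i; rewrite -subr_gt0 => /lt0r_neq0 h0.
by rewrite tE; case: h => ->; field.
Qed.

Let t_lt1 i x : B x -> peval (t i) x ^+ 2 < 1.
Proof.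
move=> /(_ i) /andP[ax xb]; rewrite tE expr_div_n.
have h : 0 < b ord0 i - a ord0 i by rewrite subr_gt0.
by rewrite ltr_pdivrMr ?exprn_gt0// mul1r; nra.
Qed.

Lemma bump_le1 N x : B x -> `|peval (bump_poly N) x| <= 1.
Proof.
move=> Bx; rewrite peval_bump normr_prod; apply: prodr_ile1 => i _.
rewrite normr_ge0/=.
have := t_lt1 i Bx; have := sqr_ge0 (peval (t i) x); set s := _ ^+ 2 => s0 s1.
have := exprn_ge0 N s0; have : s ^+ N <= 1 by rewrite exprn_ile1// ltW.
by move=> h1 h2; rewrite ger0_norm; lra.
Qed.

Lemma bump_cvg1 x : B x -> peval (bump_poly N) x @[N --> \oo] --> (1 : R).
Proof.
move=> Bx.
have h (s : seq 'I_d) : \prod_(i <- s) (1 - peval (t i) x ^+ 2 ^+ N) @[N --> \oo] -->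
    \prod_(i <- s) (1 : R).
  elim: s => [|i s IH].
    by rewrite big_nil; under eq_fun do rewrite big_nil; exact: cvg_cst.
  rewrite big_cons; under eq_fun do rewrite big_cons.
  apply: cvgM => //.
  have ht : peval (t i) x ^+ 2 ^+ N @[N --> \oo] --> (0 : R).
    by apply: cvg_expr; rewrite ger0_norm ?sqr_ge0// t_lt1.
  by have ht1 := cvgB (cvg_cst (1 : R)) ht; rewrite subr0 in ht1; exact: ht1.
rewrite (_ : (fun N => _) = fun N => \prod_i (1 - peval (t i) x ^+ 2 ^+ N)).
  by have := h (index_enum 'I_d); rewrite big1.
by apply/funext => N; rewrite peval_bump.
Qed.

(** Dominated convergence with majorant [|h|]: the polynomials are bounded by 1 on the box and tend
    to 1 there. *)
Lemma integral_box_bump_eq0 (h : 'rV[R]_d -> R) :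
  (leb R d).-integrable B (EFin \o h) ->
  (forall N, \int[leb R d]_(x in B) (peval (bump_poly N) x * h x)%:E = 0)%E ->
  (\int[leb R d]_(x in B) (h x)%:E = 0)%E.
Proof.
move=> hi h0.
have mB : measurable B by exact: measurable_box.
have mh : measurable_fun B h by apply/measurable_EFinP; exact: (measurable_int _ hi).
have := @dominated_convergence _ _ _ (leb R d) B mB
  (fun N x => (peval (bump_poly N) x * h x)%:E) (EFin \o h) (fun x => `|h x|%:E).
case.
- move=> N; apply/measurable_EFinP; apply: measurable_funM => //.
  by apply: measurable_funTS; apply: continuous_rV_measurable; exact: continuous_peval.
- exact/measurable_EFinP.
- apply: aeW => x Bx; apply/fine_cvgP; split; first exact: nearW.
  by have hx := cvgM (bump_cvg1 Bx) (cvg_cst (h x)); rewrite mul1r in hx; exact: hx.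
- exact: integrable_abse hi.
- apply: aeW => x N Bx; rewrite lee_fin normrM ler_piMl//.
  exact: bump_le1.
move=> _ _; rewrite (_ : [sequence _]_n = cst 0%E); last by apply/funext => N /=.
by move=> /cvg_lim <-//; rewrite lim_cst.
Qed.

End bump.

Section weak_divergence.
Variables (R : realType) (d : nat) (D : set 'rV[R]_d) (A A' : 'rV[R]_d).
Hypotheses (mD : measurable D) (bD : D `<=` box A A').
Implicit Types (f g w : 'rV[R]_d -> R) (p : mpoly d R).

Lemma bounded_leb_lty : (leb R d D < +oo)%E.
Proof.
apply: le_lt_trans (leb_box_lty A A'); apply: le_measure => //; rewrite inE//.
exact: measurable_box.
Qed.

Lemma L2_continuous f : continuous f -> L2 D f.
Proof.
move=> cf; have [M hM] := continuous_bounded_box A A' cf.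
apply: (@L2_bounded _ _ _ mD _ M) => //; first exact: bounded_leb_lty.
  by apply: measurable_funTS; exact: continuous_rV_measurable.
by move=> x /bD; exact: hM.
Qed.

Lemma L2_peval p : L2 D (peval p).
Proof. by apply: L2_continuous; exact: continuous_peval. Qed.

Lemma L2S (E : set 'rV[R]_d) f : measurable E -> E `<=` D -> L2 D f -> L2 E f.
Proof.
move=> mE ED /(L2P mD)[mf fi]; apply/(L2P mE); split.
  exact: measurable_funS mf.
exact: integrableS fi.
Qed.

Lemma L2_restrict (E : set 'rV[R]_d) f : measurable E -> L2 D f -> L2 D (f \_ E).
Proof.
move=> mE /(L2P mD)[mf fi]; apply/(L2P mD); split.
  apply/measurable_restrict => //; apply: measurable_funS mf => //.
apply: (le_integrable mD _ _ fi).
  apply/measurable_EFinP/measurable_funX; apply/measurable_restrict => //.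
  exact: measurable_funS mf.
move=> x Dx /=; rewrite lee_fin patchE; case: ifPn => // _.
by rewrite expr0n normr0.
Qed.

Lemma ip_restrict (E : set 'rV[R]_d) f g : E `<=` D ->
  ip D (f \_ E) g = ip E f g.
Proof.
move=> ED; rewrite /ip [RHS]Rintegral_mkcond [LHS]Rintegral_mkcond.
apply: eq_Rintegral => x _; rewrite !patchE.
case: (boolP (x \in E)) => [|_]; last by case: ifP; rewrite ?mul0r.
by rewrite inE => /ED xD; rewrite mem_set.
Qed.

End weak_divergence.

Lemma cvg_sumr (R : realType) (I : Type) (s : seq I) (F : I -> nat -> R) (l : I -> R) :
  (forall i, F i m @[m --> \oo] --> l i) ->
  \sum_(i <- s) F i m @[m --> \oo] --> \sum_(i <- s) l i.
Proof.
move=> Fl; elim: s => [|i s IH].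
  by rewrite big_nil; under eq_fun do rewrite big_nil; exact: cvg_cst.
by rewrite big_cons; under eq_fun do rewrite big_cons; exact: cvgD.
Qed.

(** * Integration by parts against polynomials, and its limit for weak divergences *)

Section by_parts.
Variables (R : realType) (d : nat).
Implicit Types (f g w : 'rV[R]_d -> R) (p : mpoly d R) (a b : 'rV[R]_d).

(** The product of [p] and [f] vanishes on the two hyperplanes bounding the box in direction [i], so
    its partial derivative has integral zero. *)
Lemma ip_box_by_parts a b p f i :
  (forall x : 'rV[R]_d, x ord0 i = a ord0 i \/ x ord0 i = b ord0 i -> peval p x = 0) ->
  C1_fun f ->
  ip (box a b) (peval p) (partial i f) = - ip (box a b) (peval (mderiv i p)) f.
Proof.
move=> p0 [cf /(_ i) [cdf df]].
have cp := @continuous_peval R d.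
have c1 : continuous (fun x => peval p x * partial i f x).
  by move=> x; apply: continuousM; [exact: cp|exact: cdf].
have c2 : continuous (fun x => peval (mderiv i p) x * f x).
  by move=> x; apply: continuousM; [exact: cp|exact: cf].
apply/eqP; rewrite -addr_eq0 /ip -RintegralD//;
  [|exact: measurable_box|exact: continuous_integrable_box..].
apply/eqP; rewrite /Rintegral.
suff -> : (\int[leb R d]_(x in box a b)
    (peval p x * partial i f x + peval (mderiv i p) x * f x)%:E = 0)%E by [].
apply: (@integral_box_derive R d i a b (fun x => peval p x * f x)).
- by move=> x; exact: (continuousD (c1 x) (c2 x)).
- move=> x; have := is_deriveM (is_derive_peval p i x) (df x).
  by rewrite [X in is_derive _ _ _ (_ + X)]mulrC.
- by move=> x /p0 ->; rewrite mul0r.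
Qed.

Variables (D : set 'rV[R]_d) (A A' : 'rV[R]_d).
Hypotheses (mD : measurable D) (bD : D `<=` box A A').

(** Against a polynomial vanishing on the boundary of the box, both [w] and the classical divergence
    can be integrated by parts, with the same result. The bump polynomials then remove the test
    function. *)
Lemma weak_divergence_box (phi : nat -> 'rV[R]_d -> 'rV[R]_d) v w a b
    (V : 'I_d -> mpoly d R) :
  (forall m i, C1_fun (component (phi m) i)) ->
  (forall i, L2 D (component v i)) -> L2 D w ->
  (forall i, L2norm D (fun x => component (phi m) i x - component v i x)
                      @[m --> \oo] --> 0%E) ->
  L2norm D (fun x => divergence (phi m) x - w x) @[m --> \oo] --> 0%E ->
  box a b `<=` D ->
  (forall x, box a b x -> forall i, component v i x = peval (V i) x) ->
  (\int[leb R d]_(x in box a b) (w x)%:E =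
   \int[leb R d]_(x in box a b) (\sum_i peval (mderiv i (V i)) x)%:E)%E.
Proof.
move=> C1phi v2 w2 phiv phiw BD vV.
have [ab|] := pselect (forall i, a ord0 i < b ord0 i); last first.
  move=> /existsNP[i] /negP; rewrite -leNgt => ba.
  suff -> : box a b = set0 by rewrite !integral_set0.
  apply/seteqP; split => x // /(_ i) /andP[h1 h2].
  by have := lt_trans h1 h2; rewrite ltNge ba.
set B := box a b; have mB : measurable B by exact: measurable_box.
have L2c f : continuous f -> L2 D f := L2_continuous mD bD (f := f).
have L20 : L2 D (cst 0) by apply: L2c; exact: cst_continuous.
have pD q : L2 D (peval q) := L2_peval mD bD q.
pose W x := \sum_i peval (mderiv i (V i)) x.
have cW : L2 D W.
  by apply: L2_sum => // i _; exact: pD.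
have wB := L2S mD mB BD w2; have WB := L2S mD mB BD cW.
have one : L2 B (peval 1) by exact: (L2S mD mB BD).
have peval1 x : @peval R d 1 x = 1 by rewrite /peval meval1.
have iB f : L2 B f -> (leb R d).-integrable B (EFin \o f).
  move=> hf; have := L2_mul mB hf one; apply: eq_integrable => // x _ /=.
  by rewrite peval1 mulr1.
suff h0 : (\int[leb R d]_(x in B) (w x - W x)%:E = 0)%E.
  move: h0; under eq_integral do rewrite EFinB.
  rewrite integralB_EFin//; [|exact: iB..].
  have wfin := integrable_fin_num mB (iB _ wB).
  by move/eqP; rewrite sube_eq ?add0e// => /eqP.
apply: (@integral_box_bump_eq0 _ _ _ _ ab).
  by apply: iB; exact: L2B.
move=> N; set p := bump_poly a b N.
have p0 i (x : 'rV[R]_d) : x ord0 i = a ord0 i \/ x ord0 i = b ord0 i -> peval p x = 0.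
  exact: bump_eq0.
have pB q : L2 B (peval q) by exact: (L2S mD mB BD).
rewrite (_ : (fun x => _) = EFin \o (fun x => (w x - W x) * peval p x)); last first.
  by apply/funext => x /=; rewrite mulrC.
rewrite -(@fineK _ (integral _ _ _)); last first.
  by apply: integrable_fin_num => //; apply: L2_mul => //; exact: L2B.
congr EFin; rewrite -/(Rintegral _ _ _) -/(ip B (fun x => w x - W x) (peval p)).
rewrite ipBl//; apply/eqP; rewrite subr_eq0; apply/eqP.
have L20B : L2 B (cst 0) by exact: (L2S mD mB BD).
have phi2 m i : L2 D (component (phi m) i).
  by apply: L2c; have [] := C1phi m i.
have dphi2 m i : L2 D (partial i (component (phi m) i)).
  by apply: L2c; have [_ /(_ i)[]] := C1phi m i.
have div2 m : L2 D (divergence (phi m)) by apply: L2_sum => // i _; exact: dphi2.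
(* The common value: for [W] it comes from integrating the polynomials [V i] by parts, for [w] from
   the limit of the same identity for [phi m]. *)
transitivity (- \sum_i ip B (component v i) (peval (mderiv i p))); last first.
  rewrite [RHS]ip_suml//.
  rewrite -sumrN; apply: eq_bigr => i _.
  rewrite [RHS]ipC -[peval (mderiv i (V i))]partial_peval ip_box_by_parts; [|exact: p0|exact: C1_peval].
  congr (- _); rewrite ipC; apply: eq_Rintegral => x; rewrite inE => xB.
  by rewrite (vV x xB).
(* Convergence is given in the norm on [D], so the test polynomial is cut off outside [B] rather
   than the domain restricted. *)
have L : ip D (divergence (phi m)) (peval p \_ B) @[m --> \oo] --> ip D w (peval p \_ B).
  by apply: cvg_ip => //; exact: L2_restrict.
have E m : ip D (divergence (phi m)) (peval p \_ B) =
    - \sum_i ip D (component (phi m) i) (peval (mderiv i p) \_ B).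
  rewrite ipC ip_restrict// ipC [LHS]ip_suml//; last first.
    by move=> i _; apply: (L2S mD mB BD); exact: dphi2.
  rewrite -sumrN; apply: eq_bigr => i _.
  by rewrite ipC ip_box_by_parts; [rewrite [in RHS]ipC ip_restrict|exact: p0|exact: C1phi].
have Rr : - \sum_i ip D (component (phi m) i) (peval (mderiv i p) \_ B) @[m --> \oo] -->
    - \sum_i ip D (component v i) (peval (mderiv i p) \_ B).
  apply: cvgN; apply: cvg_sumr => i; apply: cvg_ip => //.
  by exact: L2_restrict.
rewrite (funext E) in L; have := cvg_lim (@Rhausdorff R) L.
rewrite (cvg_lim (@Rhausdorff R) Rr) [RHS]ipC ip_restrict// [RHS]ipC => <-; congr (- _); apply: eq_bigr => i _.
by rewrite ipC ip_restrict// ipC.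
Qed.

End by_parts.

(** Inside a fixed box, equality of integrals spreads from sub-boxes to all measurable sets by
    Dynkin's theorem, which gives equality almost everywhere there. Countably many rational boxes
    then cover [U]. *)
Lemma ae_eq_boxes (R : realType) d (U : set 'rV[R]_d) (f g : 'rV[R]_d -> R) :
  open U -> (leb R d).-integrable U (EFin \o f) -> (leb R d).-integrable U (EFin \o g) ->
  (forall a b, box a b `<=` U ->
    \int[leb R d]_(x in box a b) (f x)%:E = \int[leb R d]_(x in box a b) (g x)%:E)%E ->
  {ae leb R d, forall x, U x -> f x = g x}.
Proof.
move=> oU fi gi fg; have mU := open_rV_measurable oU.
have aeB a b : box a b `<=` U -> {ae leb R d, forall x, box a b x -> f x = g x}.
  move=> BU; have mB := measurable_box a b.
  have fB : (leb R d).-integrable (box a b) (EFin \o f) by exact: integrableS fi.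
  have gB : (leb R d).-integrable (box a b) (EFin \o g) by exact: integrableS gi.
  have : ae_eq (leb R d) (box a b) (EFin \o f) (EFin \o g).
    apply: integral_ae_eq => //; first exact: (measurable_int _ gB).
    move=> E EB mE.
    have intS h S : measurable S -> (leb R d).-integrable (box a b) (EFin \o h) ->
        (leb R d).-integrable (box a b `&` S) (EFin \o h).
      by by move=> mS; apply: integrableS => //; exact: measurableI.
    pose P S := (\int[leb R d]_(x in box a b `&` S) (f x)%:E =
                 \int[leb R d]_(x in box a b `&` S) (g x)%:E)%E.
    suff : P E by rewrite /P setIidr.
    apply: (@dynkin_induction _ 'rV[R]_d (@boxes R d) P).
    - exact: measurable_boxesE.
    - exact: boxes_setI.
    - by rewrite /P setIT; exact: fg.
    - move=> _ [a' [b' ->]]; rewrite /P box_setI; apply: fg.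
      by rewrite -box_setI => x [/BU].
    - move=> S mS SE.
      (* Integrability keeps the integrals finite, so the one over a complement is a genuine
         difference. *)
      have hS h : (leb R d).-integrable (box a b) (EFin \o h) ->
          (\int[leb R d]_(x in box a b `&` ~` S) (h x)%:E =
           \int[leb R d]_(x in box a b) (h x)%:E -
           \int[leb R d]_(x in box a b `&` S) (h x)%:E)%E.
        move=> hB; have mSC := measurableC mS.
        have -> : (\int[leb R d]_(x in box a b) (h x)%:E =
           \int[leb R d]_(x in box a b `&` ~` S) (h x)%:E +
           \int[leb R d]_(x in box a b `&` S) (h x)%:E)%E.
          rewrite -integral_setU//=; try exact: measurableI.
          + by rewrite -setIUr setUC setUv setIT.
          + by rewrite -setIUr setUC setUv setIT; exact: (measurable_int _ hB).
          + by apply/disj_set2P; rewrite setIACA setICl setI0.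
        by rewrite addeK// integrable_fin_num//; [exact: measurableI|exact: intS].
      by rewrite /P !hS// SE fg.
    - move=> F mF tF hF; rewrite /P setI_bigcupr.
      have tBF : trivIset [set: nat] (fun k => box a b `&` F k).
        exact: trivIset_setIl.
      have mBF k : measurable (box a b `&` F k) by exact: measurableI.
      have iF h : (leb R d).-integrable (box a b) (EFin \o h) ->
          (leb R d).-integrable (\bigcup_k (box a b `&` F k)) (EFin \o h).
        by move=> hi; rewrite -setI_bigcupr; apply: intS => //; exact: bigcupT_measurable.
      rewrite !integral_bigcup//; [|exact: iF..].
      by apply: eq_eseriesr => k _; exact: hF.
    - by rewrite -measurable_boxesE.
  by apply: filterS => x /= h xB; have [] := h xB.
(* The exceptional sets of the rational boxes, enumerated by [nat] for countable subadditivity; an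
   integer coding no box contributes the empty set. *)
pose F k := if @unpickle ('rV[rat]_d * 'rV[rat]_d)%type k is Some pq then
  [set x | ~ (box (map_mx ratr pq.1) (map_mx ratr pq.2) `<=` U ->
    box (map_mx ratr pq.1) (map_mx ratr pq.2) x -> f x = g x)] else set0.
have nF k : (leb R d).-negligible (F k).
  rewrite /F; case: unpickle => [pq|]; last exact: negligible_set0.
  have [pqU|npqU] := pselect (box (map_mx ratr pq.1) (map_mx ratr pq.2) `<=` U).
    by apply: negligibleS (aeB _ _ pqU) => x /= + h; apply.
  by apply: negligibleS (negligible_set0 _) => x /=; apply.
apply: negligibleS (negligible_bigcup nF) => x /= nx.
have [Ux fgx] : U x /\ f x <> g x by apply/not_implyP.
have [pq pqU pqx] := open_nbhs_ratr_box oU Ux.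
by exists (pickle pq) => //; rewrite /F pickleK /= => /(_ pqU pqx).
Qed.

(** * Test functions and projections *)

Lemma bounded_set_box (R : realType) d (D : set 'rV[R]_d) : bounded_set D ->
  exists A A', D `<=` box A A'.
Proof.
move=> [M [_ hM]].
(* Boundedness gives a weak bound for each number above [M], such as [M + 1]; the second unit makes
   the inequalities strict. *)
exists (\row__ (- (M + 2))), (\row__ (M + 2)) => x Dx i.
have := hM (M + 1) _ x Dx; rewrite ltrDl => /(_ ltr01) h.
have : ball (0 : 'rV[R]_d) (M + 2) x.
  by rewrite -ball_normE /= sub0r normrN; apply: le_lt_trans h _; lra.
move=> [_ /(_ ord0 i)]; rewrite /ball/= !mxE sub0r normrN ltr_norml.
by [].
Qed.

Section test_functions.
Variables (R : realType) (d : nat) (D : set 'rV[R]_d).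

Lemma test_fun_C1 f : test_fun D f -> C1_fun f.
Proof.
move=> [sf _ _]; split=> [x|i].
  by apply: differentiable_continuous; exact: (sf [::]).
split=> [x|x]; first by apply: differentiable_continuous; exact: (sf [:: i]).
by apply: derivableP; apply: diff_derivable; exact: (sf [::]).
Qed.

Lemma test_fun_out f x : test_fun D f -> ~ D x -> f x = 0.
Proof.
move=> [_ _ suppD] nDx; apply: contrapT => /eqP fx0; apply: nDx.
by apply: suppD; exact: subset_closure.
Qed.

(** The complement of the support is open and contains [x], so [f] vanishes in a whole neighbourhood
    of [x]. *)
Lemma test_fun_partial_out f i x : test_fun D f -> ~ D x -> partial i f x = 0.
Proof.
move=> [_ _ suppD] nDx.
have nsx : (~` closure [set y | f y != 0]) x by move=> /suppD.
have osupp : open (~` closure [set y | f y != 0]).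
  by apply: closed_openC; exact: closed_closure.
transitivity ('D_(delta_mx ord0 i) (cst 0 : 'rV[R]_d -> R) x).
  apply: near_eq_derive; apply: filterS (open_nbhs_nbhs (conj osupp nsx)) => y ny.
  by apply: contrapT => /eqP fy; apply: ny; exact: subset_closure.
exact: derive_cst.
Qed.

Variables (A A' : 'rV[R]_d).
Hypotheses (mD : measurable D) (bD : D `<=` box A A').

(** Extension by zero moves the integral to the enclosing open box, whose bounding hyperplanes miss
    [D]. This is why a constant may be subtracted from the potential later. *)
Lemma ip_test_fun_partial f i : test_fun D f -> ip D (partial i f) (cst 1) = 0.
Proof.
move=> tf; have [cf /(_ i) [cdf df]] := test_fun_C1 tf.
rewrite /ip Rintegral_mkcond.
rewrite (_ : _ \_ D = (partial i f) \_ (box A A')); last first.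
  apply/funext => x; rewrite !patchE mulr1.
  case: (boolP (x \in D)) => [|]; first by rewrite inE => /bD xb; rewrite mem_set.
  by rewrite notin_setE => /(test_fun_partial_out i tf) ->; case: ifP.
rewrite -Rintegral_mkcond /Rintegral.
suff -> : (\int[leb R d]_(x in box A A') (partial i f x)%:E = 0)%E by [].
apply: (@integral_box_derive R d i A A' f) => // x xAA'.
apply: (test_fun_out tf) => /bD /(_ i).
by case: xAA' => ->; rewrite ltxx ?andbF.
Qed.

End test_functions.

(** * Orthogonal projection onto polynomials of bounded degree *)

Section projection.
Variables (R : realType) (d : nat) (D : set 'rV[R]_d) (A A' : 'rV[R]_d).
Hypotheses (mD : measurable D) (bD : D `<=` box A A').

Lemma ip_eq0 (f r : 'rV[R]_d -> R) : L2 D f -> L2 D r -> ip D r r = 0 -> ip D f r = 0.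
Proof.
move=> f2 r2 rr0.
(* [t |-> ip (f + t r) (f + t r)] is nonnegative and affine, hence constant. *)
have ge0 t : 0 <= ip D f f + 2 * t * ip D f r.
  have tr : L2 D (fun x => t * r x) by exact: L2Z.
  have h2 := L2D mD f2 tr.
  have : 0 <= ip D (fun x => f x + t * r x) (fun x => f x + t * r x).
    by apply: Rintegral_ge0 => x _; rewrite -expr2 sqr_ge0.
  rewrite ipDl// ipZl// ![ip D _ (fun x => f x + _)]ipC !ipDl// !ipZl// rr0.
  by rewrite [ip D r f]ipC; lra.
(* This value of [t] would make the nonnegative affine function equal to -1. *)
apply: contrapT => /eqP c0; have := ge0 (- (ip D f f + 1) / (2 * ip D f r)).
rewrite (_ : 2 * _ * _ = - (ip D f f + 1)); first lra.
by field.
Qed.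

Lemma L2_projection k (f : 'rV[R]_d -> R) : L2 D f ->
  exists2 p : mpoly d R, (mpoly.msize p <= k)%N &
    forall s : mpoly d R, (mpoly.msize s <= k)%N ->
      ip D (peval p) (peval s) = ip D f (peval s).
Proof.
move=> f2.
(* The exponents of total degree less than [k] index a monomial basis of the polynomials with
   [msize] at most [k]. *)
pose I : finType := bmultinom d k; pose n := #|I|.
pose e (i : 'I_n) : mpoly d R := @mpolyX d R (bmnm (enum_val i)).
have p2 p : L2 D (peval p) := L2_peval mD bD p.
pose lc (c : 'I_n -> R) : mpoly d R := \sum_i c i *: e i.
have lcE c x : peval (lc c) x = \sum_i c i * peval (e i) x.
  by rewrite /peval /lc raddf_sum; apply: eq_bigr => i _; rewrite /= mevalZ.
have L20 : L2 D (cst 0) by apply: (L2_continuous mD bD); exact: cst_continuous.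
have iplc g c : L2 D g -> ip D (peval (lc c)) g = \sum_i c i * ip D (peval (e i)) g.
  move=> g2; rewrite (funext (lcE c)) ip_suml//; last by move=> i _; exact: L2Z.
  by apply: eq_bigr => i _; rewrite ipZl.
have lcP s : (mpoly.msize s <= k)%N -> exists c, s = lc c.
  move=> sk; exists (fun i => mcoeff (bmnm (enum_val i)) s).
  rewrite {1}(mpolywE sk) /lc (reindex (@enum_val I predT))//.
  exact/onW_bij/enum_val_bij.
pose G : 'M[R]_n := \matrix_(i, j) ip D (peval (e i)) (peval (e j)).
pose b : 'rV[R]_n := \row_j ip D f (peval (e j)).
(* [G] is singular when [D] is null, so the normal equations are solved by
   checking that [b] annihilates the kernel of [G]. *)
have /submxP[c bcG] : (b <= G)%MS.
  rewrite submxE; apply/eqP/rowP => j; rewrite mxE [RHS]mxE.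
  pose y i := cokermx G i j.
  have Gy i : \sum_l ip D (peval (e i)) (peval (e l)) * y l = 0.
    have := congr1 (fun M : 'M[R]_n => M i j) (mulmx_coker G); rewrite mxE [RHS]mxE => h.
    rewrite -[RHS]h.
    by apply: eq_bigr => l _; rewrite mxE.
  (* A kernel vector of the Gram matrix is a polynomial of zero norm, which [ip_eq0] makes
     orthogonal to [f]. *)
  have yy : ip D (peval (lc y)) (peval (lc y)) = 0.
    rewrite iplc// big1// => i _; rewrite ipC iplc//.
    rewrite (_ : \sum_(l < n) _ = 0) ?mulr0// -[RHS](Gy i).
    by apply: eq_bigr => l _; rewrite mulrC ipC.
  rewrite -[RHS](ip_eq0 f2 (p2 _) yy) ipC iplc//.
  by apply: eq_bigr => l _; rewrite mxE mulrC ipC.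
exists (lc (c ord0)).
  apply: leq_trans; first exact: mmeasure_sum.
  apply/bigmax_leqP_seq => i _ _; apply: (leq_trans (msizeZ_le _ _)).
  by rewrite msizeX; case: (enum_val i).
move=> s /lcP[u ->]; rewrite ipC iplc// [RHS]ipC iplc//.
apply: eq_bigr => j _; congr (_ * _).
rewrite [LHS]ipC [RHS]ipC iplc//.
have := congr1 (fun M : 'rV[R]_n => M ord0 j) bcG; rewrite !mxE => ->.
by apply: eq_bigr => i _; rewrite mxE.
Qed.

End projection.

(** * Geometry of simplices *)

Lemma continuous_dotv (R : realType) d (a : 'rV[R]_d) : continuous (dotv a).
Proof.
rewrite (_ : dotv a = peval (\sum_i a ord0 i *: @mpolyX d R (mnm1 i))).
  exact: continuous_peval.
apply/funext => x; rewrite /peval raddf_sum; apply: eq_bigr => i _.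
by rewrite /= mevalZ mevalXU.
Qed.

Section simplices.
Variables (R : realType) (n : nat) (K : mesh R n).
Implicit Types S T : {set vertex K}.

Let row1 (y : 'rV[R]_n.+1) : 'rV[R]_(1 + n.+1) := row_mx 1 y.

(* Homogeneous coordinates of the vertices: affine dependencies are the linear
   dependencies between the rows. *)
Let vertex_mx S : 'M[R]_(#|S|, 1 + n.+1) := \matrix_(i < #|S|) row1 (pos (enum_val i)).

(** The matrix of homogeneous coordinates has [n + 2] columns and fewer rows, so some nonzero column
    [y] is annihilated by it. The entries of [y] are the coefficients of an affine equation valid at
    every vertex, hence on the hull. *)
Lemma hull_sub_hyperplane S : (#|S| <= n.+1)%N ->
  exists c a, a != 0 /\ hull S `<=` [set x | c + dotv a x = 0].
Proof.
move=> Sn.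
(* An empty vertex set has an empty hull, since no weights sum to 1, and any hyperplane will do. *)
have [->|[v0 v0S]] := set_0Vmem S.
  exists 0, (const_mx 1); split; last first.
    move=> x [c [_]]; rewrite big_set0 => /eqP.
    by rewrite eq_sym oner_eq0.
  apply/eqP => /rowP /(_ ord0) /eqP; rewrite !mxE oner_eq0//.
have : cokermx (vertex_mx S) != 0.
  rewrite -mxrank_eq0 mxrank_coker -lt0n subn_gt0.
  by apply: leq_ltn_trans (rank_leq_row _) _; rewrite add1n ltnS.
move=> /matrix0Pn[i0 [j yj]].
pose y : 'cV[R]_(1 + n.+1) := col j (cokermx (vertex_mx S)).
have y0 : y != 0.
  apply/eqP => /(congr1 (fun M : 'cV[R]_(1 + n.+1) => M i0 0)).
  by rewrite [LHS]mxE [RHS]mxE => /eqP; rewrite (negbTE yj).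
have vy v : v \in S -> usubmx y 0 0 + dotv (dsubmx y)^T (pos v) = 0.
  move=> vS.
  have : row1 (pos v) *m y = 0.
    have <- : row (enum_rank_in vS v) (vertex_mx S) = row1 (pos v).
      by rewrite rowK enum_rankK_in.
    by rewrite /y colE mulmxA -row_mul mulmx_coker raddf0 mul0mx.
  rewrite /row1 -{1}(vsubmxK y) mul_row_col mul1mx => h.
  rewrite (_ : dotv _ _ = (pos v *m dsubmx y) 0 0); last first.
    by rewrite mxE; apply: eq_bigr => i _; rewrite mxE mulrC.
  by have := congr1 (fun M : 'M[R]_1 => M 0 0) h; rewrite [LHS]mxE [RHS]mxE.
(* If the linear part were zero, the equation at the vertex [v0] would make the constant term vanish
   too, against [y0]. *)
exists (usubmx y 0 0), (dsubmx y)^T; split.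
  apply: contra_neq y0 => a0; have := vy _ v0S.
  rewrite a0 {1}/dotv big1 => [|i _]; last by rewrite mxE mul0r.
  rewrite addr0 => c0; rewrite -(vsubmxK y).
  rewrite (_ : usubmx y = 0); last first.
    by apply/matrixP => i k; rewrite !ord1 c0 mxE.
  by rewrite -[dsubmx y]trmxK a0 trmx0 col_mx0.
move=> x [c [_ c1 ->]] /=.
rewrite -[X in X + _]mul1r -c1 mulr_suml.
have -> : dotv (dsubmx y)^T (\sum_(a in S) c a *: pos a) =
    \sum_(a in S) c a * dotv (dsubmx y)^T (pos a).
  rewrite /dotv; under eq_bigr do rewrite summxE mulr_sumr.
  rewrite exchange_big/=; apply: eq_bigr => a _; rewrite mulr_sumr.
  by apply: eq_bigr => i _; rewrite !mxE mulrCA.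
by rewrite -big_split big1//= => a aS; rewrite -mulrDr vy// mulr0.
Qed.

(** With fewer vertices the hull would lie in a hyperplane, and a short step along an axis where the
    normal has a nonzero entry leaves it. *)
Lemma interior_hull_card S x : interior (hull S) x -> (n.+1 < #|S|)%N.
Proof.
move=> /nbhs_ballP[e /= e0 eS]; rewrite ltnNge; apply/negP => /hull_sub_hyperplane.
move=> [c [a [/rV0Pn[j aj] Sa]]].
have h1 := Sa _ (eS _ (ballxx x e0)).
have : ball x e (x + (e / 2) *: delta_mx ord0 j).
  split => // i k; rewrite /ball/= !mxE opprD addNKr normrN.
  rewrite normrM ger0_norm; last by rewrite divr_ge0// ltW.
  apply: (@le_lt_trans _ _ (e / 2)); last by lra.
  by rewrite ler_piMr//; [lra|case: (_ && _); rewrite ?normr1 ?normr0].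
move=> /eS /Sa /=; rewrite (_ : dotv a _ = dotv a x + (e / 2) * a ord0 j); last first.
  rewrite /dotv (bigD1 j)//= [in RHS](bigD1 j)//= !mxE !eqxx/= mulr1.
  rewrite [X in _ + X = _](_ : _ = \sum_(i < n.+1 | i != j) a ord0 i * x ord0 i); last first.
    by apply: eq_bigr => i ij; rewrite !mxE (negbTE ij) andbF mulr0 addr0.
  lra.
move: h1 => /= h1; rewrite addrA h1 add0r => /eqP; rewrite mulf_eq0 (negbTE aj) orbF.
by apply/negP; lra.
Qed.

Lemma negligible_hull S : (#|S| <= n.+1)%N -> (leb R n.+1).-negligible (hull S).
Proof.
move=> /hull_sub_hyperplane[c [a [a0 Sa]]].
apply: negligibleS Sa _; apply/negligibleP; last exact: leb_hyperplane.
rewrite -[X in measurable X]setTI.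
have /continuous_rV_measurable : continuous (fun x => c + dotv a x).
  by move=> x; apply: continuousD; [exact: cst_continuous|exact: continuous_dotv].
by move=> /(_ measurableT [set 0]); apply; exact: measurable_set1.
Qed.

Let row1_sum (I : finType) (P : pred I) (c : I -> R) (p : I -> 'rV[R]_n.+1) :
  \sum_(i | P i) c i *: row1 (p i) =
  row_mx (\sum_(i | P i) c i)%:M (\sum_(i | P i) c i *: p i).
Proof.
rewrite -[LHS]hsubmxK !linear_sum/=; congr row_mx.
  apply/matrixP => i j; rewrite !ord1 summxE mxE eqxx mulr1n.
  by apply: eq_bigr => k _; rewrite linearZ/= row_mxKl !mxE mulr1.
by apply: eq_bigr => k _; rewrite linearZ/= row_mxKr.
Qed.

Let sum_vertex_mx T (w : 'rV[R]_#|T|) (c : vertex K -> R) :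
  (forall i, c (enum_val i) = w 0 i) ->
  w *m vertex_mx T = row_mx (\sum_(a in T) c a)%:M (\sum_(a in T) c a *: pos a).
Proof.
move=> cw; rewrite mulmx_sum_row -row1_sum [RHS]big_enum_val.
by apply: eq_bigr => i _; rewrite rowK cw.
Qed.

(** [hull] asks for weights that are nonnegative at every vertex of the mesh, hence the value 0
    outside [T]. *)
Let vertex_weight T v0 (v0T : v0 \in T) (w : 'rV[R]_#|T|) (a : vertex K) : R :=
  if a \in T then w 0 (enum_rank_in v0T a) else 0.

Let vertex_weightE T v0 (v0T : v0 \in T) w i :
  vertex_weight v0T w (enum_val i) = w 0 i.
Proof. by rewrite /vertex_weight enum_valP enum_valK_in. Qed.

(** Affine independence makes the square matrix of homogeneous coordinates invertible. Barycentric
    coordinates are thus affine functions of the point, and positivity at [x] persists nearby by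
    continuity. *)
Lemma interior_hull_pos T (c : vertex K -> R) : #|T| = n.+2 ->
  affinely_independent T -> (forall a, a \in T -> 0 < c a) ->
  \sum_(a in T) c a = 1 -> interior (hull T) (\sum_(a in T) c a *: pos a).
Proof.
move=> Tn aT c0 c1; set x := \sum_(a in T) _.
have [v0 v0T] : exists v0, v0 \in T by apply/card_gt0P; rewrite Tn.
have Mfree : row_free (vertex_mx T).
  apply: inj_row_free => w; rewrite (sum_vertex_mx (vertex_weightE v0T w)).
  rewrite -(row_mx0 R 1 1 n.+1) => /eq_row_mx[h1 h2].
  apply/rowP => i; rewrite mxE -(vertex_weightE v0T w).
  apply: aT => //; last exact: enum_valP.
  by move/matrixP : h1 => /(_ 0 0); rewrite !mxE eqxx mulr1n.
have Mfull : row_full (vertex_mx T).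
  by rewrite /row_full (eqP Mfree) Tn.
pose w y := row1 y *m pinvmx (vertex_mx T).
have wE y : w y *m vertex_mx T = row1 y by rewrite mulmxKpV// submx_full.
have wx i : w x 0 i = c (enum_val i).
  have -> : w x = \row_i c (enum_val i).
    apply: (row_free_inj Mfree); rewrite wE.
    by rewrite (@sum_vertex_mx _ _ c) => [|j]; [rewrite c1|rewrite mxE].
  by rewrite mxE.
have wc i : continuous (fun y => w y 0 i).
  pose N := pinvmx (vertex_mx T).
  rewrite (_ : (fun _ => _) = fun y => usubmx N 0 i + dotv (col i (dsubmx N))^T y).
    by move=> y; apply: continuousD; [exact: cst_continuous|exact: continuous_dotv].
  apply/funext => y; rewrite /w /row1 -/N -{1}(vsubmxK N) mul_row_col mul1mx.
  rewrite [LHS]mxE; congr (_ + _); rewrite [LHS]mxE; apply: eq_bigr => j _.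
  by rewrite mulrC; congr (_ * _); rewrite [RHS]mxE [RHS]mxE.
have : \forall y \near nbhs x, forall i, 0 < w y 0 i.
  apply: filter_forall => i.
  have : nbhs (w x 0 i) [set t | 0 < t].
    by apply: open_nbhs_nbhs; split; [exact: open_gt|rewrite /= wx c0// enum_valP].
  exact: (wc i).
apply: filterS => y wy.
have := wE y; rewrite (sum_vertex_mx (vertex_weightE v0T (w y))).
move=> /eq_row_mx[h1 h2]; exists (vertex_weight v0T (w y)); split => //.
- by move=> a; rewrite /vertex_weight; case: ifP => // _; exact: ltW.
- by move/matrixP : h1 => /(_ 0 0); rewrite !mxE eqxx mulr1n.
Qed.

Lemma hull_interior_or_face T x : #|T| = n.+2 -> affinely_independent T ->
  hull T x -> interior (hull T) x \/ exists2 a, a \in T & hull (T :\ a) x.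
Proof.
move=> Tn aT [c [c0 c1 xE]].
have [cpos|] := pselect (forall a, a \in T -> 0 < c a).
  by left; rewrite xE; exact: interior_hull_pos.
move=> /existsNP[a /not_implyP[aT' /negP]]; rewrite -leNgt => ca.
have ca0 : c a = 0 by apply/eqP; rewrite eq_le ca c0.
right; exists a => //; exists c; split=> //.
  by rewrite -c1 [RHS](big_setD1 a)//= ca0 add0r.
by rewrite xE [LHS](big_setD1 a)//= ca0 scale0r add0r.
Qed.

Variable Omega : set 'rV[R]_n.+1.
Hypothesis hK : triangulates K Omega.

(** By conformity the two cells meet in the hull of their common vertices; a hull with interior
    needs [n + 2] of them, which is all. *)
Lemma interior_cell_inj S T x : S \in cells K -> T \in cells K ->
  interior (hull S) x -> interior (hull T) x -> S = T.
Proof.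
move: hK => [cK _ IK] SK TK Sx Tx.
have : interior (hull (S :&: T)) x by rewrite -IK// interiorI.
move/interior_hull_card => h.
have [cS _] := cK _ SK; have [cT _] := cK _ TK.
apply/eqP; rewrite eqEcard cS cT leqnn andbT.
apply/finset.setIidPl/eqP; rewrite eqEcard subsetIl cS.
exact: h.
Qed.

(** The points left out lie on the finitely many facets of cells, each contained in a hyperplane. *)
Lemma ae_interior_cell : {ae leb R n.+1, forall x, Omega x ->
  exists2 T, T \in cells K & interior (hull T) x}.
Proof.
move: hK => [cK OK _].
have : \forall x \near almost_everywhere (leb R n.+1),
    forall T (a : vertex K), T \in cells K -> a \in T -> ~ hull (T :\ a) x.
  apply: filter_forall => T; apply: filter_forall => a.
  have [TK|nTK] := boolP (T \in cells K); last by apply: aeW.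
  have [aT|naT] := boolP (a \in T); last by apply: aeW.
  have [Tn _] := cK _ TK.
  have : (#|T :\ a| <= n.+1)%N by rewrite -ltnS -Tn [X in (_ < X)%N](cardsD1 a) aT.
  by move=> /negligible_hull; apply: negligibleS => x /= /not_implyP[_ /not_implyP[_ /contrapT]].
apply: filterS => x hx Ox.
have : closure Omega x by exact: subset_closure.
rewrite OK => -[T /= TK Tx]; exists T => //.
have [Tn aT] := cK _ TK.
by have [//|[a aT' ax]] := hull_interior_or_face Tn aT Tx; case: (hx T a TK aT').
Qed.

End simplices.

(** * Broken functions and hydrostatic balance *)

Section zero_field.
Variables (R : realType) (n : nat) (K : mesh R n).
Local Notation E := 'rV[R]_n.+1.
Implicit Types (v vh : {set vertex K} -> E -> E).

Lemma bdry_int_eq0 T (f : {set vertex K} -> E -> R) :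
  (forall F x, f F x = 0) -> bdry_int T f = 0.
Proof.
move=> f0; apply: big1 => a _; rewrite /face_int.
rewrite (_ : (fun t => _) = cst 0); first by rewrite /Rintegral integral0 mulr0.
by apply/funext => t; rewrite f0.
Qed.

Lemma dot0v d (x : 'rV[R]_d) : dotv 0 x = 0.
Proof. by rewrite /dotv big1// => i _; rewrite mxE mul0r. Qed.

Lemma dotv0 d (x : 'rV[R]_d) : dotv x 0 = 0.
Proof. by rewrite /dotv big1// => i _; rewrite [X in _ * X]mxE mulr0. Qed.

Lemma component0 d i : component (fun=> 0 : 'rV[R]_d) i = cst 0.
Proof. by apply/funext => x; rewrite /component mxE. Qed.

Lemma partial0 d (i : 'I_d) : partial i (cst 0 : 'rV[R]_d -> R) = cst 0.
Proof. by apply/funext => x; exact: derive_cst. Qed.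

Lemma gradv0 d (x : 'rV[R]_d) : gradv (fun=> 0) x = 0.
Proof. by apply/matrixP => i j; rewrite !mxE component0 partial0. Qed.

Lemma a_h_zerol nu alpha k v vh :
  a_h nu alpha k (fun _ _ => 0) (fun _ _ => 0) v vh = 0.
Proof.
rewrite /a_h big1 ?mulr0// => T TK.
rewrite !bdry_int_eq0 => [|F x|F x|F x]; first last.
- by rewrite /gradvn gradv0 trmx0 mulmx0 dot0v.
- by rewrite subrr /tang dot0v scale0r subrr dotv0.
- by rewrite subrr /tang dot0v scale0r subrr dot0v.
rewrite mulr0 !addr0 /Rintegral (_ : (fun x => _) = cst 0%E) ?integral0//.
by apply/funext => x; rewrite gradv0 /frob mul0mx mxtrace0.
Qed.

Lemma c_h_zero rho lam : c_h (K := K) rho (fun _ _ => 0) lam = 0.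
Proof.
rewrite /c_h big1// => T TK; rewrite bdry_int_eq0 => [|F x]; last by rewrite dot0v !mul0r.
rewrite addr0 /ipv /Rintegral (_ : (fun x => _) = cst 0%E) ?integral0 ?oppr0//.
by apply/funext => x; rewrite scaler0 dot0v.
Qed.

Lemma is_poly0 d m : is_poly m (cst 0 : 'rV[R]_d -> R).
Proof. by exists 0; rewrite ?mmeasure0// => x; rewrite meval0. Qed.

Lemma is_polyv0 d m : is_polyv m (fun=> 0 : 'rV[R]_d).
Proof. by move=> i; rewrite component0; exact: is_poly0. Qed.

Lemma test_fun0 d (D : set 'rV[R]_d) : test_fun D (cst 0).
Proof.
have supp0 : closure [set x : 'rV[R]_d | (cst 0 x : R) != 0] = set0.
  by rewrite -[RHS]closure0; congr closure; apply/seteqP; split => x //=; rewrite eqxx.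
split => [s x||]; [|rewrite supp0; exact: compact0|rewrite supp0//].
rewrite (_ : foldr _ _ _ = cst 0); first exact: differentiable_cst.
by elim: s => //= i s ->; exact: partial0.
Qed.

Lemma H0div_zero d (D : set 'rV[R]_d) : H0div D (fun=> 0).
Proof.
have L0 : L2 D (cst 0).
  rewrite /L2 (_ : _ \_ D = 0); first by have [] := @Lfun_addr_closed _ _ R (leb R d) 2%:E (_ : (1 <= 2%:E)%E); rewrite ?lee1n.
  by apply/funext => x; rewrite patchE; case: ifP.
have N0 : L2norm D (fun x : 'rV[R]_d => 0 - 0) = 0%E.
  rewrite /L2norm (_ : _ \o _ = cst 0%E) ?Lnorm0//.
  by apply/funext => x /=; rewrite patchE subrr; case: ifP.
split; first by move=> i; rewrite component0.
exists (cst 0); split => //.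
- move=> phi _; rewrite /ipv /ip /Rintegral.
  rewrite (_ : (fun x => (dotv _ _)%:E) = cst 0%E); last first.
    by apply/funext => x; rewrite dot0v.
  rewrite (_ : (fun x => (_ * _)%:E) = cst 0%E); last first.
    by apply/funext => x; rewrite mul0r.
  by rewrite integral0 oppr0.
- exists (fun _ _ => 0); split.
  + by move=> m i; rewrite component0; exact: test_fun0.
  + by move=> i; rewrite component0 N0; exact: cvg_cst.
  + rewrite (_ : divergence _ = cst 0) ?N0; first exact: cvg_cst.
    by apply/funext => x; rewrite /divergence big1// => i _; rewrite component0 partial0.
Qed.

End zero_field.

Lemma eq_L2 (R : realType) d (D : set 'rV[R]_d) (f g : 'rV[R]_d -> R) :
  (forall x, D x -> f x = g x) -> L2 D f -> L2 D g.
Proof.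
move=> fg; rewrite /L2 (_ : f \_ D = g \_ D)//.
by apply/funext => x; rewrite !patchE; case: ifPn => //; rewrite inE => /fg.
Qed.

(** The induction over the indices carries integrability of the partial sums along, since additivity
    of the integral requires it. *)
Lemma ipv_sum (R : realType) d (D : set 'rV[R]_d) (v w : 'rV[R]_d -> 'rV[R]_d) :
  measurable D -> L2v D v -> L2v D w ->
  ipv D v w = \sum_i ip D (component v i) (component w i).
Proof.
move=> mD hv hw; rewrite /ipv /dotv.
pose F s (x : 'rV[R]_d) := \sum_(i <- s) v x ord0 i * w x ord0 i.
suff : forall s, (leb R d).-integrable D (EFin \o F s) /\
  \int[leb R d]_(x in D) F s x = \sum_(i <- s) ip D (component v i) (component w i).
  by move=> /(_ (index_enum 'I_d))[].
elim=> [|i s [IH1 IH2]].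
  have -> : F [::] = cst 0 by apply/funext => x; rewrite /F big_nil.
  by split; [exact: integrable0|rewrite big_nil Rintegral_cst// mul0r].
have hi := L2_mul mD (hv i) (hw i).
have -> : F (i :: s) = fun x => component v i x * component w i x + F s x.
  by apply/funext => x; rewrite /F big_cons.
split; first exact: (integrableD mD hi IH1).
by rewrite big_cons -IH2 /ip -RintegralD.
Qed.

Lemma ae_eq_ip (R : realType) d (D : set 'rV[R]_d) (f g h : 'rV[R]_d -> R) :
  measurable D -> L2 D f -> measurable_fun D g -> measurable_fun D h ->
  {ae leb R d, forall x, D x -> g x = h x} -> ip D f g = ip D f h.
Proof.
move=> mD /(L2P mD)[mf _] mg mh gh; rewrite /ip /Rintegral; congr fine.
apply: ae_eq_integral => //.
- by apply/measurable_EFinP; exact: measurable_funM.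
- by apply/measurable_EFinP; exact: measurable_funM.
- by apply: filterS gh => x /= gh Dx; rewrite gh.
Qed.

Lemma L2_measurable (R : realType) d (D : set 'rV[R]_d) (f : 'rV[R]_d -> R) :
  measurable D -> L2 D f -> measurable_fun D f.
Proof. by move=> mD /(L2P mD)[]. Qed.

(** * Broken functions and their cellwise divergence *)

Section broken_functions.
Variables (R : realType) (n : nat) (K : mesh R n) (Omega : set 'rV[R]_n.+1).
Variables (A A' : 'rV[R]_n.+1).
Hypotheses (hK : triangulates K Omega) (oOmega : open Omega).
Hypothesis bOmega : Omega `<=` box A A'.
Local Notation E := 'rV[R]_n.+1.
Implicit Types T : {set vertex K}.

Lemma brokenE (W : nmodType) (v : {set vertex K} -> E -> W) T x :
  T \in cells K -> interior (hull T) x -> broken v x = v T x.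
Proof.
move=> TK Tx; rewrite /broken (bigD1 T)/=; last by rewrite TK; apply/asboolP.
rewrite big1 ?addr0// => S /andP[/andP[SK /asboolP Sx]] /eqP ST.
by case: ST; apply: (interior_cell_inj hK SK TK Sx Tx).
Qed.

Let mOmega : measurable Omega := open_rV_measurable oOmega.

(** The triangulation covers the closure of [Omega], so the interior of a cell is only known to lie
    in that closure. The intersection is open and stays where the weak divergence is defined. *)
Definition cell_part T : set E := Omega `&` interior (hull T).

Lemma open_cell_part T : open (cell_part T).
Proof. by apply: openI => //; exact: open_interior. Qed.

Lemma measurable_cell_part T : measurable (cell_part T).
Proof. by apply: open_rV_measurable; exact: open_cell_part. Qed.

Lemma cell_part_sub T : cell_part T `<=` Omega.
Proof. by move=> x []. Qed.

Lemma broken_restrict (v : {set vertex K} -> E -> R) x : Omega x ->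
  broken v x = \sum_(T in cells K) (v T \_ (cell_part T)) x.
Proof.
move=> Ox; rewrite /broken big_mkcondr/=; apply: eq_bigr => T _.
rewrite patchE; congr (if _ then _ else _); apply/asboolP/idP; rewrite inE.
  by move=> Tx; split.
by case.
Qed.

Let L20 : L2 Omega (cst 0).
Proof. by apply: (L2_continuous mOmega bOmega); exact: cst_continuous. Qed.

Lemma L2_broken (v : {set vertex K} -> E -> R) :
  (forall T, T \in cells K -> L2 Omega (v T)) -> L2 Omega (broken v).
Proof.
move=> v2; apply: (@eq_L2 _ _ _ (fun x => \sum_(T in cells K) (v T \_ (cell_part T)) x)).
  by move=> x Ox; rewrite broken_restrict.
apply: L2_sum => // T TK; apply: L2_restrict; [exact: mOmega| |exact: v2].
exact: measurable_cell_part.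
Qed.

Lemma ip_broken X (v : {set vertex K} -> E -> R) : L2 Omega X ->
  (forall T, T \in cells K -> L2 Omega (v T)) ->
  ip Omega X (broken v) = \sum_(T in cells K) ip (cell_part T) X (v T).
Proof.
move=> X2 v2; rewrite ipC.
transitivity (ip Omega (fun x => \sum_(T in cells K) (v T \_ (cell_part T)) x) X).
  by apply: eq_Rintegral => x; rewrite inE => Ox; rewrite broken_restrict.
rewrite ip_suml//; last first.
  move=> T TK; apply: L2_restrict; [exact: mOmega| |exact: v2].
  exact: measurable_cell_part.
by apply: eq_bigr => T _; rewrite ip_restrict; [exact: ipC|exact: cell_part_sub].
Qed.

Lemma is_polyv_peval m (u : E -> E) : is_polyv m u ->
  exists2 V : 'I_n.+1 -> mpoly n.+1 R, forall i, (mpoly.msize (V i) <= m.+1)%N &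
    forall i, component u i = peval (V i).
Proof.
move=> hu; have /choice[V hV] i : exists p : mpoly n.+1 R,
    (mpoly.msize p <= m.+1)%N /\ component u i = peval p.
  by have [p pm pE] := hu i; exists p; split => //; exact/funext.
by exists V => i; have [] := hV i.
Qed.

Lemma divergence_peval (u : E -> E) (V : 'I_n.+1 -> mpoly n.+1 R) :
  (forall i, component u i = peval (V i)) ->
  divergence u = peval (\sum_i mderiv i (V i)).
Proof.
move=> uV; apply/funext => x; rewrite /divergence /peval raddf_sum.
by apply: eq_bigr => i _; rewrite uV partial_peval.
Qed.

(** Differentiation lowers the degree by one, so the divergence of a discrete velocity is cellwise
    in the density space. *)
Lemma is_polyv_divergence m (u : E -> E) : is_polyv m.+1 u ->
  exists2 s : mpoly n.+1 R, (mpoly.msize s <= m.+1)%N & divergence u = peval s.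
Proof.
move=> /is_polyv_peval[V Vm uV]; exists (\sum_i mderiv i (V i)).
  apply: leq_trans; first exact: mmeasure_sum.
  by apply/bigmax_leqP_seq => i _ _; exact: msize_mderiv.
exact: divergence_peval.
Qed.

(** On the open part of a cell [broken v] is a polynomial, so [weak_divergence_box] holds on all
    boxes there and [ae_eq_boxes] applies. Finitely many cells fill [Omega] up to a null set. *)
Lemma weak_divergence_broken m (v : {set vertex K} -> E -> E) w (phi : nat -> E -> E) :
  (forall T, T \in cells K -> is_polyv m (v T)) ->
  L2v Omega (broken v) -> L2 Omega w ->
  (forall m' i, test_fun Omega (component (phi m') i)) ->
  (forall i, L2norm Omega (fun x => component (phi m') i x - component (broken v) i x)
                      @[m' --> \oo] --> 0%E) ->
  L2norm Omega (fun x => divergence (phi m') x - w x) @[m' --> \oo] --> 0%E ->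
  {ae leb R n.+1, forall x, Omega x -> w x = broken (fun T => divergence (v T)) x}.
Proof.
move=> vpoly v2 w2 tphi phiv phiw.
have aeT T : T \in cells K ->
    {ae leb R n.+1, forall x, cell_part T x -> w x = divergence (v T) x}.
  move=> TK; have [V _ vV] := is_polyv_peval (vpoly T TK).
  have mT := measurable_cell_part T; have sT := @cell_part_sub T.
  have one : L2 Omega (cst 1).
    by apply: (L2_continuous mOmega bOmega); exact: cst_continuous.
  have int f : L2 Omega f -> (leb R n.+1).-integrable (cell_part T) (EFin \o f).
    move=> f2; have := L2_mul mOmega f2 one.
    move/(integrableS mOmega mT sT); apply: eq_integrable => // x _ /=.
    by rewrite mulr1.
  have div2 : L2 Omega (divergence (v T)).
    by rewrite (divergence_peval vV); exact: (L2_peval mOmega bOmega).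
  apply: (ae_eq_boxes (@open_cell_part T) (int _ w2) (int _ div2)) => a b abT.
  rewrite (weak_divergence_box (A := A) (A' := A') mOmega bOmega (phi := phi)
    (v := broken v) (w := w) (V := V))//.
  - apply: eq_integral => x _; rewrite (divergence_peval vV); congr EFin.
    by rewrite /peval raddf_sum.
  - by move=> m' i; exact: (test_fun_C1 (tphi m' i)).
  - by move=> x /abT; exact: sT.
  - move=> x /abT[_ Tx] i; rewrite /component (brokenE _ TK Tx).
    by rewrite -vV.
have : \forall x \near almost_everywhere (leb R n.+1), forall T, T \in cells K ->
    cell_part T x -> w x = divergence (v T) x.
  apply: filter_forall => T.
  have [/aeT|nTK] := boolP (T \in cells K); last by apply: aeW.
  by apply: filterS => x hx _; exact: hx.
move=> aeall; apply: filterS2 aeall (ae_interior_cell hK) => x hx1 hx2 Ox.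
have [T TK Tx] := hx2 Ox.
by rewrite (brokenE _ TK Tx); apply: hx1.
Qed.

End broken_functions.

(** The definition of the weak gradient gives the identity for the test fields [phi m], and both
    sides pass to the limit. The constant [C] drops out because partial derivatives of test
    functions have mean zero. *)
Lemma ipv_weak_grad_H0div (R : realType) d (Omega : set 'rV[R]_d) A A'
    (q : 'rV[R]_d -> R) (f v : 'rV[R]_d -> 'rV[R]_d) w
    (phi : nat -> 'rV[R]_d -> 'rV[R]_d) (C : R) :
  measurable Omega -> Omega `<=` box A A' ->
  H1_grad Omega q f -> L2v Omega v -> L2 Omega w ->
  (forall m i, test_fun Omega (component (phi m) i)) ->
  (forall i, L2norm Omega (fun x => component (phi m) i x - component v i x)
                      @[m --> \oo] --> 0%E) ->
  L2norm Omega (fun x => divergence (phi m) x - w x) @[m --> \oo] --> 0%E ->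
  ipv Omega f v = - ip Omega (fun x => q x - C) w.
Proof.
move=> mO bO [q2 f2 qf] v2 w2 tphi phiv phiw.
have cst2 c : L2 Omega (cst c) by apply: (L2_continuous mO bO); exact: cst_continuous.
have L2c g : continuous g -> L2 Omega g := L2_continuous mO bO (f := g).
have phi2 m i : L2 Omega (component (phi m) i).
  by apply: L2c; have [] := test_fun_C1 (tphi m i).
have dphi2 m i : L2 Omega (partial i (component (phi m) i)).
  by apply: L2c; have [_ /(_ i)[]] := test_fun_C1 (tphi m i).
have div2 m : L2 Omega (divergence (phi m)) by apply: L2_sum => // i _; exact: dphi2.
have qC2 : L2 Omega (fun x => q x - C) by exact: (L2B mO q2 (cst2 C)).
have Em m : \sum_i ip Omega (component (phi m) i) (component f i) =
    - ip Omega (divergence (phi m)) (fun x => q x - C).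
  rewrite ipC (ipBl mO q2 (cst2 C) (div2 m)).
  have -> : ip Omega (cst C) (divergence (phi m)) = 0.
    rewrite (_ : cst C = fun x => C * cst 1 x); last by apply/funext => x; rewrite mulr1.
    rewrite ipZl// ipC [X in _ * X]ip_suml//.
    rewrite [X in _ * X]big1 ?mulr0// => i _.
    exact: (ip_test_fun_partial bO).
  rewrite subr0 ipC [in RHS]ip_suml//.
  rewrite -sumrN; apply: eq_bigr => i _; rewrite [LHS]ipC [in RHS]ipC qf//.
  by rewrite opprK.
have L : \sum_i ip Omega (component (phi m) i) (component f i) @[m --> \oo] -->
    \sum_i ip Omega (component v i) (component f i).
  by apply: cvg_sumr => i; apply: cvg_ip.
have Rr : - ip Omega (divergence (phi m)) (fun x => q x - C) @[m --> \oo] -->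
    - ip Omega w (fun x => q x - C).
  by apply: cvgN; apply: cvg_ip.
rewrite (funext Em) in L.
rewrite ipv_sum// [in RHS]ipC -(cvg_lim (@Rhausdorff R) Rr) (cvg_lim (@Rhausdorff R) L).
by apply: eq_bigr => i _; rewrite ipC.
Qed.

Theorem lemma3p2 (R : realType) (n : nat) (hn : n = 1%N \/ n = 2%N)
    (Omega : set 'rV[R]_n.+1) (hOmega : lipschitz_domain Omega)
    (K : mesh R n) (hK : triangulates K Omega)
    (sigma tau : R) (hsigma : shape_regular K sigma) (htau : quasi_uniform K tau)
    (nF : {set vertex K} -> 'rV[R]_n.+1)
    (hnF : forall F, F \in faces K -> unit_normal F (nF F))
    (k : nat) (hk : (1 <= k)%N)
    (nu alpha cM M : R)
    (hnu : 0 < nu) (halpha : 0 < alpha) (hcM : 0 < cM) (hM : 0 < M)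
    (hcoercive : coercive Omega nF nu alpha k) :
  gradient_robust Omega nF k nu alpha cM M.
Proof.
(* From here [k] is the degree of the densities and [k.+1] that of the velocities; a density
   polynomial has [msize] at most [k.+1]. *)
case: k hk hcoercive => [//|k _ _].
have [oO _ _ /bounded_set_box[A [A' bO]] _] := hOmega.
have mO : measurable Omega by exact: open_rV_measurable.
move=> f g f2 ginf g0 [q qf [C [_ mass]]].
have [q2 _ _] := qf.
have pO p : L2 Omega (peval p) := L2_peval mO bO p.
have cst2 c : L2 Omega (cst c) by apply: (L2_continuous mO bO); exact: cst_continuous.
have qC2 : L2 Omega (fun x => q x - C) by exact: (L2B mO q2 (cst2 C)).
pose rho x := (q x - C) / cM.
have rho2 : L2 Omega rho.
  rewrite (_ : rho = fun x => cM^-1 * (q x - C)); first exact: L2Z.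
  by apply/funext => x; rewrite mulrC.
have proj (T : {set vertex K}) : exists p : mpoly n.+1 R, (mpoly.msize p <= k.+1)%N /\
    forall s : mpoly n.+1 R, (mpoly.msize s <= k.+1)%N ->
      ip (cell_part Omega T) (peval p) (peval s) = ip (cell_part Omega T) rho (peval s).
  have mT : measurable (cell_part (K := K) Omega T) by exact: measurable_cell_part.
  have sT : cell_part (K := K) Omega T `<=` Omega by exact: cell_part_sub.
  have [p pk pE] := L2_projection mT (subset_trans sT bO) k.+1 (L2S mO mT sT rho2).
  by exists p.
have [pT pTE] := choice proj.
pose rhoh T := peval (pT T).
have rhoh_mass T (s : mpoly n.+1 R) : (mpoly.msize s <= k.+1)%N ->
    ip (cell_part Omega T) (rhoh T) (peval s) = ip (cell_part Omega T) rho (peval s).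
  by have [_] := pTE T; apply.
have rhohQ : in_Qh k.+1 rhoh.
  by move=> T TK; exists (pT T) => //; have [] := pTE T.
have brho2 : L2 Omega (broken rhoh) by apply: (L2_broken oO bO) => T TK; exact: pO.
have ip_brokenC X (s : {set vertex K} -> mpoly n.+1 R) : L2 Omega X ->
    ip Omega X (broken (fun T => peval (s T))) =
    \sum_(T in cells K) ip (cell_part Omega T) X (peval (s T)).
  by move=> X2; rewrite (ip_broken oO bO).
(* Testing against piecewise P_(k-1) functions does not distinguish the
   projection from rho. *)
have rhohE (s : {set vertex K} -> mpoly n.+1 R) :
    (forall T, T \in cells K -> (mpoly.msize (s T) <= k.+1)%N) ->
    ip Omega (broken rhoh) (broken (fun T => peval (s T))) =
    ip Omega rho (broken (fun T => peval (s T))).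
  move=> sk; rewrite !ip_brokenC//; apply: eq_bigr => T TK.
  rewrite -rhoh_mass; last exact: sk.
  apply: eq_Rintegral => x; rewrite inE => -[_ Tx].
  by rewrite (brokenE hK _ TK Tx).
exists rhoh => //; split; first split => //.
- split=> [T TK|]; first exact: is_polyv0.
  rewrite (_ : broken _ = fun=> 0); first exact: H0div_zero.
  by apply/funext => x; rewrite /broken big1.
- move=> F FK; split => //; first by exists (fun=> 0) => //; exact: is_polyv0.
  by move=> x _; exact: dot0v.
split => [v vh [vpoly [v2 [w [w2 vw [phi [tphi phiv phiw]]]]]] _|lam _|].
(* Outside the cells the polynomial is arbitrary and 0 is taken, so that the choice is made for
   every [T]. *)
- have /choice[s sE] T : exists s : mpoly n.+1 R, T \in cells K ->
      (mpoly.msize s <= k.+1)%N /\ divergence (v T) = peval s.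
    have [TK|_] := boolP (T \in cells K); last by exists 0.
    by have [s] := is_polyv_divergence (vpoly T TK); exists s.
  have divE : broken (fun T => divergence (v T)) = broken (fun T => peval (s T)).
    apply/funext => x; apply: eq_bigr => T /andP[TK _].
    by have [_ ->] := sE T TK.
  rewrite a_h_zerol sub0r (ipv_weak_grad_H0div C mO bO qf v2 w2 tphi phiv phiw).
  (* The integrand vanishes almost everywhere with [g]; the measurability of [g] comes from its
     membership in the essentially bounded functions. *)
  have -> : ipv Omega g (fun x => broken rhoh x *: broken v x) = 0.
    have mg i : measurable_fun Omega (component g i).
      apply/(measurable_restrictT _ mO); have := ginf i; rewrite inE => /andP[h _].
      by rewrite inE in h.
    have mW i : measurable_fun Omega (fun x => (broken rhoh x *: broken v x) ord0 i).
      rewrite (_ : (fun x => _) = broken rhoh \* component (broken v) i).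
        by apply: measurable_funM; exact: L2_measurable.
      by apply/funext => x; rewrite mxE.
    rewrite /ipv /Rintegral (ae_eq_integral (cst 0%E)) ?integral0//.
      apply/measurable_EFinP; apply: measurable_sum => i; apply: measurable_funM => //.
      exact: mg.
    by apply: filterS g0 => x /= gx /gx ->; rewrite dot0v.
  rewrite addr0; congr (- _).
  have bdiv2 : L2 Omega (broken (fun T => peval (s T))).
    by apply: (L2_broken oO bO) => T TK; exact: pO.
  have wdiv := weak_divergence_broken hK oO bO vpoly v2 w2 tphi phiv phiw.
  rewrite divE in wdiv *.
  (* Once [w] is a broken polynomial of degree at most [k], the projected density may be exchanged
     for [rho], and [cM] times [rho] is [q - C]. *)
  rewrite (ae_eq_ip mO qC2 _ _ wdiv); [|exact: L2_measurable..].
  rewrite ipZl// rhohE => [|T TK]; last by have [] := sE T TK.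
  rewrite -ipZl//; apply: eq_Rintegral => x _.
  by rewrite /rho mulrCA mulfV ?mulr1// gt_eqF.
- exact: c_h_zero.
- rewrite -mass -/rho.
  (* The constant 1 agrees almost everywhere with the broken polynomial 1, of [msize] 1, so the
     projection also preserves the total mass. *)
  have one2 : L2 Omega (broken (fun T : {set vertex K} => @peval R n.+1 1)).
    by apply: (L2_broken oO bO) => T TK; exact: pO.
  have ae1 : {ae leb R n.+1, forall x, Omega x ->
      cst 1 x = broken (fun T : {set vertex K} => @peval R n.+1 1) x}.
    apply: filterS (ae_interior_cell hK) => x /= hx Ox; have [T TK Tx] := hx Ox.
    by rewrite (brokenE hK _ TK Tx) /peval meval1.
  rewrite (ae_eq_ip mO brho2 _ _ ae1); [|exact: L2_measurable..].
  rewrite (ae_eq_ip mO rho2 _ _ ae1); [|exact: L2_measurable..].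
  by apply: rhohE => T TK; rewrite msize1.
Qed.
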